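(* For each positive rational number $\alpha$, the $8$-dimensional nilmanifold $N_{\alpha}=\Gamma_\alpha\backslash G_\alpha$ has generalized complex structures of every type $k$, for $0\leq k\leq 4$.
   Context: **The nilmanifolds $N_\alpha$.** A nilmanifold is a compact quotient $\Gamma\backslash G$ of a connected and simply connected nilpotent real Lie group $G$ by a lattice $\Gamma$ of maximal rank. For a positive rational number $\alpha\in\mathbb{Q}^+$, let $\mathfrak{g}_\alpha$ be the $8$-dimensional real nilpotent Lie algebra whose dual $\mathfrak{g}_\alpha^*$ has a basis $\{e^i\}_{i=1}^8$ with Chevalley–Eilenberg differential (convention $de(X,Y)=-e([X,Y])$) $$de^1=de^2=de^3=de^4=0,\qquad de^5=e^{12},\qquad de^6=e^{15}+(1-\alpha)e^{24},$$ $$de^7=-(1+\alpha)e^{14}-e^{23}+(1+\alpha)e^{25},\qquad de^8=e^{16}+e^{27}+e^{34}-2e^{45},$$ where $e^{ij}=e^i\wedge e^j$. Let $G_\alpha$ be the connected, simply connected nilpotent Lie group with Lie algebra $\mathfrak{g}_\alpha$. Since the structure constants are rational, $G_\alpha$ has a lattice $\Gamma_\alpha$ of maximal rank (Mal'cev); fix one and set $N_\alpha=\Gamma_\alpha\backslash G_\alpha$. **Generalized complex structures.** Let $M$ be a compact differentiable manifold of dimension $2n$. Equip $TM\oplus T^*M$ with the pairing $\langle X+\xi\mid Y+\eta\rangle=\frac12(\xi(Y)+\eta(X))$ and the Courant bracket $[X+\xi,Y+\eta]=[X,Y]+\mathcal{L}_X\eta-\mathcal{L}_Y\xi-\frac12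 d(\iota_X\eta-\iota_Y\xi)$ on smooth sections. A generalized complex structure on $M$ is an endomorphism $\mathcal{J}$ of $TM\oplus T^*M$, orthogonal for the pairing, with $\mathcal{J}^2=-1$, whose $i$-eigenbundle $L\subset(TM\oplus T^*M)\otimes\mathbb{C}$ is involutive for the Courant bracket. With the action $(X+\xi)\cdot\rho=\iota_X\rho+\xi\wedge\rho$ on forms, the canonical line bundle $K\subset\bigwedge^\bullet T^*M\otimes\mathbb{C}$ is the line bundle determined by $L=\mathrm{Ann}(K)=\{u\mid u\cdot K=0\}$. At each point any nonzero $\rho\in K$ can be written as $\rho=e^{B+i\omega}\,\Omega$ (up to a nonzero scalar absorbed in $\Omega$), where $B,\omega$ are real $2$-forms and $\Omega=\theta^1\wedge\cdots\wedge\theta^k$ is a decomposable complex $k$-form with $\omega^{n-k}\wedge\Omega\wedge\overline{\Omega}\neq 0$. The integer $k$, $0\leq k\leq n$, is called the type; a generalized complex structure is of type $k$ if its type equals $k$ at every point. Type $n$ corresponds to complex structures and type $0$ to symplectic structures. *)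

(* Defs.v *)
From HB Require Import structures.
From mathcomp Require Import all_boot all_order all_algebra.
From mathcomp Require Import all_classical all_reals all_analysis.
From mathcomp Require Import complex.
Set Implicit Arguments.
Unset Strict Implicit.
Unset Printing Implicit Defensive.
Import Order.TTheory GRing.Theory Num.Theory.
Import numFieldNormedType.Exports.
Local Open Scope ring_scope.

(** * Complex exterior algebra of R^m

   A complex form at a point is the family of its coefficients in the basis
   dx_S = dx_{j_1} /\ ... /\ dx_{j_p}, for S = {j_1 < ... < j_p}. *)

Section ExteriorAlgebra.
Context {R : realType} {m : nat}.
Local Notation C := R[i].
Local Notation index_set := {set 'I_m}.
Local Notation form := {ffun {set 'I_m} -> R[i]}.

Definition form1 : form := [ffun S : index_set => (#|S| == 0%N)%:R].

(* dx_U /\ dx_V = wsign U V * dx_(U :|: V) for disjoint U and V. *)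
Definition wsign (U V : index_set) : C :=
  (-1) ^+ #|[pred p : 'I_m * 'I_m |
              [&& p.1 \in U, p.2 \in V & (p.2 < p.1)%N]]|.

Definition wedge (a b : form) : form :=
  [ffun S : index_set => \sum_(U : index_set | U \subset S)
                           wsign U (S :\: U)%SET * a U * b (S :\: U)%SET].

Definition wpow (a : form) (k : nat) : form := iter k (wedge a) form1.

Definition covector (xi : 'rV[C]_m) : form :=
  [ffun S : index_set => \sum_(j | S == [set j]%SET) xi 0 j].

Definition wprod (k : nat) (theta : 'I_k -> 'rV[C]_m) : form :=
  \big[wedge/form1]_(i < k) covector (theta i).

(* The exponential series, for a form [a] without constant term: its powers of
   exponent larger than m vanish. *)
Definition wexp (a : form) : form :=
  [ffun S : index_set => \sum_(k < m.+1) (k`!%:R)^-1 * wpow a k S].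

Definition contract (X : 'rV[C]_m) (a : form) : form :=
  [ffun S : index_set => \sum_(j | j \notin S)
                           wsign [set j]%SET S * X 0 j * a (j |: S)%SET].

Definition conj_form (a : form) : form := [ffun S : index_set => (a S)^*%C].

Definition scale_form (c : C) (a : form) : form :=
  [ffun S : index_set => c * a S].

Definition real_2form (a : form) : Prop :=
  forall S : index_set, (#|S| <> 2%N -> a S = 0) /\ complex.Im (a S) = 0.

Definition cvec (a b : 'rV[R]_m) : 'rV[C]_m := \row_j (a 0 j +i* b 0 j)%C.

(* Action on forms of the complex generalized tangent vector a + i b. *)
Definition clifford (a b : 'rV[R]_m * 'rV[R]_m) (rho : form) : form :=
  contract (cvec a.1 b.1) rho + wedge (covector (cvec a.2 b.2)) rho.

End ExteriorAlgebra.

Local Open Scope classical_set_scope.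

(** * Smooth tensor calculus on R^m

   The bases d/dx_j and dx_j identify the tangent and cotangent spaces of R^m
   at a point with ['rV[R]_m].  A vector field or a 1-form is a function
   ['rV[R]_m -> 'rV[R]_m]; a section of TM (+) T^*M is a function with values
   in ['rV[R]_m * 'rV[R]_m], the tangent component coming first. *)

(* All iterated directional derivatives exist and are Frechet differentiable
   (hence continuous), i.e. f is C^oo. *)
Definition smooth (R : realType) (V W : normedModType R) (f : V -> W) : Prop :=
  forall (s : seq V) (x : V),
    differentiable (foldr (fun (v : V) (g : V -> W) => 'D_v g) f s) x.

Section Calculus.
Context {R : realType} {m : nat}.
Local Notation E := 'rV[R]_m.
Local Notation TT := (E * E)%type.

Definition ev (xi v : E) : R := \sum_j xi 0 j * v 0 j.

Definition grad (f : E -> R) : E -> E :=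
  fun x => \row_j 'D_(delta_mx 0 j : E) f x.

Definition lie (X Y : E -> E) : E -> E :=
  fun x => 'D_(X x) Y x - 'D_(Y x) X x.

(* (L_X eta)_j = X(eta_j) + eta(d_j X). *)
Definition lie_form (X eta : E -> E) : E -> E :=
  fun x => \row_j (('D_(X x) eta x) 0 j
                   + ev (eta x) ('D_(delta_mx 0 j : E) X x)).

(* d eta (v, w) = v (eta w) - w (eta v) for the constant fields v and w. *)
Definition ext_d (eta : E -> E) (x v w : E) : R :=
  ev ('D_v eta x) w - ev ('D_w eta x) v.

Definition wedge1 (eta zeta : E -> E) (x v w : E) : R :=
  ev (eta x) v * ev (zeta x) w - ev (eta x) w * ev (zeta x) v.

Definition pairing (u v : TT) : R := 2^-1 * (ev u.2 v.1 + ev v.2 u.1).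

Definition courant (s t : E -> TT) : E -> TT :=
  let X x := (s x).1 in let xi x := (s x).2 in
  let Y x := (t x).1 in let eta x := (t x).2 in
  fun x => (lie X Y x,
            lie_form X eta x - lie_form Y xi x
            - 2^-1 *: grad (fun y => ev (eta y) (X y) - ev (xi y) (Y y)) x).

End Calculus.

(** * Generalized complex structures on a quotient of R^m

   [D] is the set of transformations of a group acting on R^m by
   diffeomorphisms, freely and properly discontinuously.  Tensor fields on the
   quotient manifold are the [D]-invariant tensor fields on R^m. *)

Section GeneralizedComplex.
Context {R : realType} {m : nat}.
Local Notation E := 'rV[R]_m.
Local Notation TT := (E * E)%type.
Local Notation form := {ffun {set 'I_m} -> R[i]}.

(* [u'] at [phi x] is the image of [u] at [x] under the map of TM (+) T^*M
   induced by the local diffeomorphism [phi]. *)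
Definition transports (phi : E -> E) (x : E) (u u' : TT) : Prop :=
  u'.1 = 'd phi x u.1 /\ forall w : E, ev u'.2 ('d phi x w) = ev u.2 w.

Definition invariant_section (D : set (E -> E)) (s : E -> TT) : Prop :=
  smooth s /\
  forall phi x, D phi -> transports phi x (s x) (s (phi x)).

(* The complex generalized tangent vector a + i b belongs to the
   i-eigenspace L_x of the complexification of J_x. *)
Definition eigenL (J : E -> TT -> TT) (x : E) (a b : TT) : Prop :=
  J x a = - b /\ J x b = a.

(* The bracket is extended C-bilinearly to the sections a + i b. *)
Definition involutive_L (D : set (E -> E)) (J : E -> TT -> TT) : Prop :=
  forall a b c d : E -> TT,
    invariant_section D a -> invariant_section D b ->
    invariant_section D c -> invariant_section D d ->
    (forall x, eigenL J x (a x) (b x)) ->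
    (forall x, eigenL J x (c x) (d x)) ->
    forall x, eigenL J x (courant a c x - courant b d x)
                         (courant a d x + courant b c x).

Record generalized_complex (D : set (E -> E)) (J : E -> TT -> TT) : Prop :=
  GeneralizedComplex {
    gc_linear : forall x (c : R) u v, J x (c *: u + v) = c *: J x u + J x v;
    gc_smooth : forall u, smooth (fun x => J x u);
    gc_invariant : forall phi x u u',
      D phi -> transports phi x u u' -> transports phi x (J x u) (J (phi x) u');
    gc_orthogonal : forall x u v, pairing (J x u) (J x v) = pairing u v;
    gc_square : forall x u, J x (J x u) = - u;
    gc_involutive : involutive_L D J }.

(* rho spans the line K_x determined by L_x = Ann(K_x). *)
Definition canonical_generator (J : E -> TT -> TT) (x : E) (rho : form) : Prop :=
  rho != 0 /\ forall a b, eigenL J x a b <-> clifford a b rho = 0.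

Definition pure_form (k : nat) (B omega : form) (theta : 'I_k -> 'rV[R[i]]_m)
    : form :=
  wedge (wexp (B + scale_form (0 +i* 1)%C omega)) (wprod theta).

Definition type_at (J : E -> TT -> TT) (k : nat) (x : E) : Prop :=
  exists (B omega : form) (theta : 'I_k -> 'rV[R[i]]_m),
    [/\ real_2form B, real_2form omega,
        wedge (wpow omega (m./2 - k))
              (wedge (wprod theta) (conj_form (wprod theta))) != 0
      & canonical_generator J x (pure_form B omega theta)].

Definition of_type (J : E -> TT -> TT) (k : nat) : Prop :=
  forall x, type_at J k x.

End GeneralizedComplex.

(** * Lie groups with underlying manifold R^m

   By the exponential map, every connected and simply connected nilpotent Lie
   group of dimension m is isomorphic to a Lie group of this kind. *)

Record lie_group (R : realType) (m : nat) := LieGroup {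
  lg_mul : 'rV[R]_m -> 'rV[R]_m -> 'rV[R]_m;
  lg_one : 'rV[R]_m;
  lg_inv : 'rV[R]_m -> 'rV[R]_m;
  lg_mulA : associative lg_mul;
  lg_mul1 : left_id lg_one lg_mul;
  lg_mulV : left_inverse lg_one lg_inv lg_mul;
  lg_smooth_mul : smooth (fun p : 'rV[R]_m * 'rV[R]_m => lg_mul p.1 p.2);
  lg_smooth_inv : smooth lg_inv }.

Section LieGroups.
Context {R : realType} {m : nat}.
Local Notation E := 'rV[R]_m.

Definition left_invariant (G : lie_group R m) (eta : E -> E) : Prop :=
  smooth eta /\
  forall g x w, ev (eta (lg_mul G g x)) ('d (lg_mul G g) x w) = ev (eta x) w.

(* Discrete and cocompact subgroups: for nilpotent groups, the lattices. *)
Record lattice (G : lie_group R m) (Gamma : set E) : Prop := Lattice {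
  lat_one : Gamma (lg_one G);
  lat_mul : forall x y, Gamma x -> Gamma y -> Gamma (lg_mul G x y);
  lat_inv : forall x, Gamma x -> Gamma (lg_inv G x);
  lat_discrete : exists2 U : set E,
    nbhs (lg_one G) U & U `&` Gamma = [set lg_one G];
  lat_cocompact : exists2 K : set E,
    compact K & forall x, exists g y, [/\ Gamma g, K y & x = lg_mul G g y] }.

Definition deck (G : lie_group R m) (Gamma : set E) : set (E -> E) :=
  lg_mul G @` Gamma.

End LieGroups.

(** * The Lie groups G_alpha *)

(* The dual of the Lie algebra of G, i.e. its space of left-invariant 1-forms,
   has a basis e^1, ..., e^8 with the Chevalley-Eilenberg differential of
   g_alpha; on left-invariant forms the latter is the exterior derivative.
   [e] is used at the indices 1, ..., 8 only. *)
Definition has_lie_algebra_g (R : realType) (alpha : rat) (G : lie_group R 8)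
    : Prop :=
  let a : R := ratr alpha in
  exists e : nat -> 'rV[R]_8 -> 'rV[R]_8,
    let w i j := wedge1 (e i) (e j) in
    [/\ forall i, (1 <= i <= 8)%N -> left_invariant G (e i),
        row_free (\matrix_(i < 8) e i.+1 (lg_one G)),
        forall i, (1 <= i <= 4)%N -> forall x u v, ext_d (e i) x u v = 0
      & forall x u v,
        [/\ ext_d (e 5%N) x u v = w 1%N 2%N x u v,
            ext_d (e 6%N) x u v = w 1%N 5%N x u v + (1 - a) * w 2%N 4%N x u v,
            ext_d (e 7%N) x u v = - (1 + a) * w 1%N 4%N x u v - w 2%N 3%N x u v
                                + (1 + a) * w 2%N 5%N x u v
          & ext_d (e 8%N) x u v = w 1%N 6%N x u v + w 2%N 7%N x u v + w 3%N 4%N x u v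
                                - 2 * w 4%N 5%N x u v]].

(* Main.v *)
From HB Require Import structures.
From mathcomp Require Import all_boot all_order all_algebra.
From mathcomp Require Import all_classical all_reals all_analysis.
From mathcomp Require Import complex ring.
Require Import Defs.
Set Implicit Arguments.
Unset Strict Implicit.
Unset Printing Implicit Defensive.
Import Order.TTheory GRing.Theory Num.Theory.
Import numFieldNormedType.Exports.
Local Open Scope ring_scope.

(* In a left-invariant coframe phi_1, ..., phi_4, psi_1, ..., psi_4, consider the
   constant structure J_k with canonical generator
     exp (\sum_(j > k) (b_j + i) phi_j /\ psi_j) /\ \prod_(j <= k) (phi_j + i psi_j),
   which has type k.  In the Nijenhuis expression of two sections of L, the terms
   that contain derivatives of the coefficients cancel, because J_k is constant,
   orthogonal and of square -1; integrability is thereby a trilinear identity in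
   the structure constants.
   For k <= 1, take (phi_j, psi_j) = (e2, e3), (e1, e8), (e5 - e3 / (1 + alpha), e7),
   (-(3 + alpha) e4, e6) and b = 0: the sum of the last three phi_j /\ psi_j is closed,
   so is e2 /\ e3, and the sum of all four is symplectic.
   For k >= 2, put s^2 = 3 + alpha and r = (1 - alpha) / (2 alpha s^2), and take the
   pairs (e1, s e2), (e3 + 2 e5, -2 alpha s e4), (e6, e7 / s), (e8, e5 + r (e3 + 2 e5)):
   the four phi_j + i psi_j are the (1, 0)-forms of a complex structure.  For k = 2
   the closure of the generator forces the coefficients b_3 = -1, b_4 = 1. *)

(** * Exterior algebra *)

(** Origin of the scalars for k >= 2, with theta_j = phi_j + i psi_j: since e34 - 2 e45 = (e3 + 2
    e5) /\ e4, the second pair consists of e3 + 2 e5 and a multiple c e4. In dtheta_3 the terms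
    phi_1 /\ psi_4 and psi_1 /\ psi_4 must combine into theta_1 /\ psi_4, which has no (0, 2)-part;
    comparing de6 with de7 / s gives s^2 = 3 + alpha. The other terms of dtheta_3 involve only the
    first two pairs, and they are of type (1, 1) exactly when r has its stated value and c = -2
    alpha s. Positivity of alpha makes s real and the denominators nonzero. Origin of the trilinear
    identity: L is maximal isotropic, so it is involutive as soon as T(l1, l2, l3) = 2 <[l1, l2],
    l3> vanishes on it. For l1 = u - i Ju, l2 = v - i Jv, l3 = w - i Jw with constant coordinates,
    the imaginary part of T is the identity that is checked, and the real part follows from it on
    replacing w by Jw. *)

Section Exterior.
Import mathcomp.boot.fintype mathcomp.boot.finset.
Context {R : realType} {m : nat}.
Local Notation C := R[i].
Local Notation index_set := {set 'I_m}.
Local Notation form := {ffun {set 'I_m} -> R[i]}.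
Implicit Types (a b c rho : form) (U V S T : index_set) (xi eta X Y : 'rV[C]_m).

(** As a product over pairs, the sign is visibly multiplicative in disjoint unions on either side;
    sign computations below reduce to this, to antisymmetry on singletons and to the square being
    1. *)
Lemma wsignE U V :
  wsign U V = \prod_(i in U) \prod_(j in V) (-1) ^+ (j < i)%N :> C.
Proof.
rewrite /wsign -sum1_card big_mkcond /= pair_big_dep /= -expr_sum; congr (_ ^+ _).
rewrite [RHS]big_mkcond /=; apply: eq_bigr => -[i j] _ /=; rewrite inE /=.
by case: (i \in U); case: (j \in V) => //=; case: ltnP.
Qed.

Lemma wsign0s S : wsign set0 S = 1 :> C.
Proof. by rewrite wsignE big_set0. Qed.

Lemma wsignUl U V T : [disjoint U & V] ->
  wsign (U :|: V)%SET T = wsign U T * wsign V T :> C.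
Proof. move=> dUV; rewrite !wsignE -bigU //; apply: eq_bigl => i; by rewrite !inE. Qed.

Lemma wsignUr U V T : [disjoint U & V] ->
  wsign T (U :|: V)%SET = wsign T U * wsign T V :> C.
Proof.
move=> dUV; rewrite !wsignE -big_split; apply: eq_bigr => i _.
by rewrite -bigU //; apply: eq_bigl => j; rewrite !inE.
Qed.

Lemma wsign_sq U V : wsign U V * wsign U V = 1 :> C.
Proof. by rewrite /wsign -expr2 sqrr_sign. Qed.

Lemma wsign1C (i j : 'I_m) : i != j ->
  wsign [set i]%SET [set j]%SET = - wsign [set j]%SET [set i]%SET :> C.
Proof.
move=> ij; rewrite !wsignE !big_set1; have := ij; rewrite -val_eqE /=.
by case: ltngtP => //= _ _; rewrite ?expr0 ?expr1 ?opprK.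
Qed.

(** Both sides are sums over the ordered partitions of S into three blocks; the right-hand one is
    indexed by T, the union of the first two blocks, and is reindexed by the second block V = T
    minus U. *)
Lemma wedgeA a b c : wedge a (wedge b c) = wedge (wedge a b) c.
Proof.
apply/ffunP => S; rewrite !ffunE.
transitivity (\sum_(U : index_set | U \subset S) \sum_(V : index_set | V \subset S :\: U)
   (wsign U (S :\: U) * a U * (wsign V (S :\: U :\: V) * b V * c (S :\: U :\: V))))%SET.
  by apply: eq_bigr => U _; rewrite ffunE big_distrr.
transitivity (\sum_(T : index_set | T \subset S) \sum_(U : index_set | U \subset T)
   (wsign T (S :\: T) * (wsign U (T :\: U) * a U * b (T :\: U)) * c (S :\: T)))%SET; last first.
  by apply: eq_bigr => T _; rewrite ffunE big_distrr big_distrl.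
rewrite [RHS](exchange_big_dep (fun U : index_set => U \subset S)) /=; last first.
  by move=> T U TS UT; apply: subset_trans UT TS.
apply: eq_bigr => U US.
rewrite [RHS](reindex_onto (fun V => U :|: V)%SET (fun T => T :\: U)%SET) /=; last first.
  move=> T /andP[_ /subsetP UT]; apply/setP => x; rewrite !inE.
  by have := UT x; case: (x \in U) => //= ->.
apply: eq_big => V.
  rewrite subUset US subsetUl andbT /= subsetD setDUl setDv set0U; congr andb.
  by apply/idP/eqP => [/setDidPl//|/setDidPl].
rewrite subsetD => /andP[VS dVU].
have dUV : [disjoint U & V] by rewrite disjoint_sym.
have -> : ((U :|: V) :\: U = V)%SET.
  by rewrite setDUl setDv set0U; apply/setDidPl.
rewrite setDDl.
have E : (S :\: U = V :|: (S :\: (U :|: V)))%SET.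
  apply/setP => x; rewrite !inE; case xV : (x \in V); case xU: (x \in U) => //=.
    by have := disjointFr dVU xV; rewrite xU.
  by rewrite (subsetP VS).
rewrite [in wsign U _]E wsignUr ?wsignUl //.
  by rewrite !mulrA; ring.
by rewrite -setI_eq0; apply/eqP/setP => x; rewrite !inE; case: (x \in V); case: (x \in U).
Qed.

Lemma wedge1f a : wedge form1 a = a.
Proof.
apply/ffunP => S; rewrite ffunE (bigD1 set0) ?sub0set //= big1 ?addr0.
  by rewrite ffunE cards0 setD0 wsign0s !mul1r.
by move=> U /andP[_ U0]; rewrite ffunE cards_eq0 (negbTE U0) mulr0 mul0r.
Qed.

Lemma wedgeDl a b c : wedge (a + b) c = wedge a c + wedge b c.
Proof.
apply/ffunP => S; rewrite !ffunE -big_split; apply: eq_bigr => U _ /=.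
by rewrite ffunE mulrDr mulrDl.
Qed.

Lemma wedgeDr a b c : wedge a (b + c) = wedge a b + wedge a c.
Proof.
apply/ffunP => S; rewrite !ffunE -big_split; apply: eq_bigr => U _ /=.
by rewrite ffunE mulrDr.
Qed.

Lemma wedgeZl (k : C) a b : wedge (scale_form k a) b = scale_form k (wedge a b).
Proof.
apply/ffunP => S; rewrite !ffunE mulr_sumr; apply: eq_bigr => U _ /=.
by rewrite ffunE; ring.
Qed.

Lemma wedgeZr (k : C) a b : wedge a (scale_form k b) = scale_form k (wedge a b).
Proof.
apply/ffunP => S; rewrite !ffunE mulr_sumr; apply: eq_bigr => U _ /=.
by rewrite ffunE; ring.
Qed.

Lemma wedge0f a : wedge 0 a = 0.
Proof. by apply/ffunP => S; rewrite !ffunE big1 // => U _; rewrite ffunE mulr0 mul0r. Qed.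

Lemma wedgef0 a : wedge a 0 = 0.
Proof. by apply/ffunP => S; rewrite !ffunE big1 // => U _; rewrite ffunE mulr0. Qed.

Lemma scale_formD (k : C) a b : scale_form k (a + b) = scale_form k a + scale_form k b.
Proof. by apply/ffunP => S; rewrite !ffunE mulrDr. Qed.

Lemma scale_form0 (k : C) : scale_form k (0 : form) = 0.
Proof. by apply/ffunP => S; rewrite !ffunE mulr0. Qed.

Lemma scale_formA (k l : C) a : scale_form k (scale_form l a) = scale_form (k * l) a.
Proof. by apply/ffunP => S; rewrite !ffunE mulrA. Qed.

Lemma wedge_covectorE xi rho S :
  wedge (covector xi) rho S =
  \sum_(j in S) wsign [set j]%SET (S :\ j)%SET * xi 0 j * rho (S :\ j)%SET.
Proof.
rewrite ffunE.
under eq_bigr => U _ do rewrite ffunE mulr_sumr mulr_suml.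
rewrite (exchange_big_dep predT) //= [RHS]big_mkcond /=; apply: eq_bigr => j _.
case: ifP => jS.
  rewrite (big_pred1 [set j]%SET) // => U /=.
  by case: eqP => [->|_]; rewrite ?andbF // sub1set jS.
by rewrite big1 // => U /andP[US /eqP E]; rewrite E sub1set jS in US.
Qed.

Lemma wsign1Dl i j S : j \in S -> i != j ->
  wsign [set i]%SET S = wsign [set i]%SET [set j]%SET * wsign [set i]%SET (S :\ j)%SET :> C.
Proof.
by move=> jS ij; rewrite -[in LHS](setD1K jS) wsignUr // disjoints1 !inE eqxx.
Qed.

(** Once the sums are exchanged, the terms for the pair (i, j) differ only by the sign between {i}
    and {j}, which is antisymmetric. The same argument serves for contractions. *)
Lemma covectorC xi eta rho :
  wedge (covector xi) (wedge (covector eta) rho) =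
  - wedge (covector eta) (wedge (covector xi) rho).
Proof.
apply/ffunP => S; rewrite [RHS]ffunE !wedge_covectorE.
under eq_bigr => i iS do rewrite wedge_covectorE mulr_sumr.
under [in RHS]eq_bigr => i iS do rewrite wedge_covectorE mulr_sumr.
rewrite [in RHS](exchange_big_dep (mem S)) /=; last by move=> i j _; rewrite inE => /andP[].
rewrite -sumrN; apply: eq_bigr => i iS; rewrite -sumrN.
apply: eq_big => j; rewrite !inE; first by rewrite eq_sym andbC iS andbT.
move=> /andP[ji jS]; have ij : i != j by rewrite eq_sym.
have -> : ((S :\ j) :\ i = (S :\ i) :\ j)%SET by rewrite !setDDl setUC.
rewrite (@wsign1Dl i j (S :\ i)) ?inE ?ji ?jS // 1?eq_sym //.
rewrite (@wsign1Dl j i (S :\ j)) ?inE 1?eq_sym ?ji ?iS //.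
have -> : ((S :\ j) :\ i = (S :\ i) :\ j)%SET by rewrite !setDDl setUC.
rewrite (@wsign1C j i) //; ring.
Qed.

Lemma contractE X rho S : contract X rho S =
  \sum_(j | j \notin S) wsign [set j]%SET S * X 0 j * rho (j |: S)%SET.
Proof. by rewrite ffunE. Qed.

Lemma contractC X Y rho : contract X (contract Y rho) = - contract Y (contract X rho).
Proof.
apply/ffunP => S; rewrite [RHS]ffunE !contractE.
under eq_bigr => i iS do rewrite contractE mulr_sumr.
under [in RHS]eq_bigr => i iS do rewrite contractE mulr_sumr.
rewrite [in RHS](exchange_big_dep (fun i => i \notin S)) /=; last first.
  by move=> i j _; rewrite !inE negb_or => /andP[].
rewrite -sumrN; apply: eq_bigr => i iS; rewrite -sumrN.
apply: eq_big => j; rewrite !inE !negb_or; first by rewrite eq_sym andbC iS andbT.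
move=> /andP[ji jS]; have ij : i != j by rewrite eq_sym.
rewrite (setUCA [set j] [set i]) (@wsign1Dl j i (i |: S)) ?setU11 // setU1K //.
rewrite (@wsign1Dl i j (j |: S)) ?setU11 1?eq_sym // setU1K //.
rewrite (@wsign1C j i) //; ring.
Qed.

(** Contraction is an antiderivation. The terms that add and remove the same index carry a squared
    sign and make up the scalar: indices outside S come from the left-hand side, indices in S from
    the right-hand one. The remaining terms cancel by antisymmetry. *)
Lemma contract_covector X xi rho :
  contract X (wedge (covector xi) rho) =
  scale_form (\sum_j xi 0 j * X 0 j) rho - wedge (covector xi) (contract X rho).
Proof.
apply/ffunP => S; rewrite contractE [RHS]ffunE [X in X + _]ffunE [X in _ + X]ffunE wedge_covectorE.
under eq_bigr => i iS do rewrite wedge_covectorE (bigD1 i) ?setU11 //= setU1K // mulrDr.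
rewrite big_split /=.
under [X in _ - X]eq_bigr => i iS do rewrite contractE (bigD1 i) ?setD11 //= setD1K // mulrDr.
rewrite big_split /= opprD addrA.
congr (_ + _).
  apply/eqP; rewrite -subr_eq0 opprB addrA subr_eq0; apply/eqP.
  rewrite mulr_suml [RHS](bigID (mem S)) /= addrC; congr (_ + _); apply: eq_bigr => i _.
    rewrite (_ : _ * _ = wsign [set i]%SET (S :\ i)%SET * wsign [set i]%SET (S :\ i)%SET *
       (xi 0 i * X 0 i * rho S)); first by rewrite wsign_sq mul1r.
    ring.
  rewrite (_ : _ * _ = wsign [set i]%SET S * wsign [set i]%SET S *
       (xi 0 i * X 0 i * rho S)); first by rewrite wsign_sq mul1r.
  ring.
under eq_bigr => i iS do rewrite mulr_sumr.
under [in RHS]eq_bigr => i iS do rewrite mulr_sumr.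
rewrite [in RHS](exchange_big_dep (fun i => i \notin S)) /=; last first.
  by move=> i j iS; rewrite !inE negb_and negbK => /andP[/orP[/eqP->|//]]; rewrite eqxx.
rewrite -sumrN; apply: eq_bigr => i iS; rewrite -sumrN.
apply: eq_big => j; rewrite !inE.
  case: (eqVneq j i) => [->|ji] /=; rewrite ?andbF ?andbT //=.
  by rewrite iS andbT.
move=> /andP[/orP[/eqP->|jS] ji]; first by rewrite eqxx in ji.
have ij : i != j by rewrite eq_sym.
have -> : ((i |: S) :\ j = i |: (S :\ j))%SET.
  apply/setP => x; rewrite !inE; case: (eqVneq x i) => [->|] //=.
  by rewrite ij.
rewrite (@wsign1Dl i j S) // (@wsign1Dl j i (i |: (S :\ j))%SET) ?setU11 //.
rewrite (_ : (i |: (S :\ j)) :\ i = S :\ j)%SET; last by rewrite setU1K // !inE (negbTE iS) andbF.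
rewrite (@wsign1C j i) //.
rewrite [LHS](_ : _ = - (wsign [set i]%SET [set j]%SET * wsign [set i]%SET [set j]%SET *
  (wsign [set i]%SET (S :\ j)%SET * X 0 i * wsign [set j]%SET (S :\ j)%SET *
   xi 0 j * rho (i |: S :\ j)%SET))).
  by rewrite wsign_sq; ring.
by ring.
Qed.

Lemma contract1 X : contract X form1 = 0.
Proof.
apply/ffunP => S; rewrite contractE ffunE big1 // => j jS.
by rewrite ffunE cards_eq0 -subset0 subUset sub1set inE mulr0.
Qed.

Lemma contractD X a b : contract X (a + b) = contract X a + contract X b.
Proof.
apply/ffunP => S; rewrite [RHS]ffunE !contractE -big_split; apply: eq_bigr => j _ /=.
by rewrite ffunE mulrDr.
Qed.

Lemma contractZ X (k : C) a : contract X (scale_form k a) = scale_form k (contract X a).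
Proof.
apply/ffunP => S; rewrite [RHS]ffunE !contractE mulr_sumr; apply: eq_bigr => j _ /=.
by rewrite ffunE; ring.
Qed.

Lemma contract0 X : contract X 0 = 0.
Proof. by apply/ffunP => S; rewrite contractE ffunE big1 // => j _; rewrite ffunE mulr0. Qed.

Lemma contractDl X Y a : contract (X + Y) a = contract X a + contract Y a.
Proof.
apply/ffunP => S; rewrite [RHS]ffunE !contractE -big_split; apply: eq_bigr => j _ /=.
by rewrite mxE mulrDr mulrDl.
Qed.

Lemma covectorD xi eta : covector (xi + eta) = covector xi + covector eta.
Proof.
apply/ffunP => S; rewrite !ffunE -big_split; apply: eq_bigr => j _ /=; by rewrite mxE.
Qed.

Lemma covectorZ (k : C) xi : covector (k *: xi) = scale_form k (covector xi).
Proof.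
apply/ffunP => S; rewrite !ffunE mulr_sumr; apply: eq_bigr => j _ /=; by rewrite mxE.
Qed.

Lemma scale_form_eq0 (k : C) a : k != 0 -> scale_form k a = 0 -> a = 0.
Proof.
move=> k0 /ffunP E; apply/ffunP => S; have := E S; rewrite !ffunE => /eqP.
by rewrite mulf_eq0 (negbTE k0) => /eqP.
Qed.

Lemma covector_sq xi rho : wedge (covector xi) (wedge (covector xi) rho) = 0.
Proof.
have /eqP := covectorC xi xi rho; rewrite -subr_eq0 opprK => /eqP E.
apply: (@scale_form_eq0 2); first by rewrite pnatr_eq0.
by rewrite -[RHS]E; apply/ffunP => S; rewrite !ffunE; ring.
Qed.

Lemma covector0 : covector (0 : 'rV[C]_m) = 0.
Proof. by apply/ffunP => S; rewrite !ffunE big1 // => j _; rewrite mxE. Qed.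

Lemma wedgefN a b : wedge a (- b) = - wedge a b.
Proof. by apply/eqP; rewrite -addr_eq0 -wedgeDr addNr wedgef0. Qed.

Definition dot xi X : C := \sum_j xi 0 j * X 0 j.

Definition cliff X xi rho := contract X rho + wedge (covector xi) rho.

Lemma cliffD X xi Y eta rho : cliff (X + Y) (xi + eta) rho = cliff X xi rho + cliff Y eta rho.
Proof. by rewrite /cliff contractDl covectorD wedgeDl addrACA. Qed.

(** This is the Clifford relation. It makes any two annihilators of a nonzero form orthogonal to
    each other. *)
Lemma cliff_anticomm X xi Y eta rho :
  cliff X xi (cliff Y eta rho) + cliff Y eta (cliff X xi rho) =
  scale_form (dot xi Y + dot eta X) rho.
Proof.
rewrite /cliff !contractD !wedgeDr !contract_covector -/(dot _ _) -/(dot _ _).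
rewrite (contractC X Y) (covectorC xi eta).
by apply/ffunP => S; rewrite !ffunE; ring.
Qed.

Definition wedges (s : seq 'rV[C]_m) rho := foldr (fun xi => wedge (covector xi)) rho s.

Lemma wedges_big (I : Type) (r : seq I) (theta : I -> 'rV[C]_m) :
  \big[wedge/form1]_(i <- r) covector (theta i) = wedges (map theta r) form1.
Proof. by elim: r => [|i r IH]; rewrite ?big_nil // big_cons IH. Qed.

Lemma wedge_wedges s a b : wedge (wedges s a) b = wedges s (wedge a b).
Proof. by elim: s => //= xi s IH; rewrite -wedgeA IH. Qed.

Lemma contract_wedges X s rho : (forall xi, xi \in s -> dot xi X = 0) ->
  contract X rho = 0 -> contract X (wedges s rho) = 0.
Proof.
move=> + rho0; elim: s => //= xi s IH H.
rewrite contract_covector -/(dot _ _) H ?mem_head // IH ?wedgef0 ?subr0.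
  by apply/ffunP => S; rewrite !ffunE mul0r.
by move=> eta etas; apply: H; rewrite inE etas orbT.
Qed.

Lemma covector_wedges xi s rho : xi \in s -> wedge (covector xi) (wedges s rho) = 0.
Proof.
elim: s => //= eta s IH; rewrite inE => /orP[/eqP->|xis]; first exact: covector_sq.
by rewrite covectorC IH // wedgef0 oppr0.
Qed.

(** Contraction with the dual vector of the first factor strips that factor, since it kills all the
    others. *)
Lemma wedges_neq0 (I : eqType) (r : seq I) (xi Z : I -> 'rV[C]_m) : uniq r ->
  (forall i j, dot (xi i) (Z j) = (i == j)%:R) -> wedges (map xi r) form1 != 0.
Proof.
move=> + H; elim: r => [_|i r IH /= /andP[ir ur]] /=.
  by apply/eqP => /ffunP /(_ set0); rewrite !ffunE cards0 => /eqP; rewrite oner_eq0.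
apply: contraNneq (IH ur) => E; have := congr1 (contract (Z i)) E.
rewrite contract0 contract_covector -/(dot _ _) H eqxx contract_wedges ?contract1 //.
  rewrite wedgef0 subr0 => /(scale_form_eq0 (oner_neq0 _)) ->; exact: eqxx.
move=> _ /mapP[j jr ->]; rewrite H; case: eqP => // ji.
by rewrite ji in jr; rewrite jr in ir.
Qed.

Lemma conj_formM a b : conj_form (wedge a b) = wedge (conj_form a) (conj_form b).
Proof.
apply/ffunP => S; rewrite !ffunE rmorph_sum; apply: eq_bigr => U _.
by rewrite !rmorphM /= !ffunE /wsign rmorph_sign.
Qed.

Lemma conj_form_wedges s : conj_form (wedges s form1) =
  wedges (map (map_mx (fun z : C => z^*%C)) s) form1.
Proof.
elim: s => [|xi s IH] /=; first by apply/ffunP => S; rewrite !ffunE rmorph_nat.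
rewrite conj_formM IH; congr wedge; apply/ffunP => S; rewrite !ffunE rmorph_sum.
by apply: eq_bigr => j _; rewrite mxE.
Qed.

End Exterior.

(** * Powers and exponentials of two-forms *)

Section TwoForms.
Import mathcomp.boot.fintype mathcomp.boot.finset.
Context {R : realType} {m : nat} {I : eqType}.
Local Notation C := R[i].
Local Notation form := {ffun {set 'I_m} -> R[i]}.
Variables xi eta : I -> 'rV[C]_m.
Implicit Types (c : I -> C) (s : seq I) (X : 'rV[C]_m) (rho Omega : form).

Definition twoform c s : form :=
  \sum_(i <- s) scale_form (c i) (wedge (covector (xi i)) (covector (eta i))).

(** The interior product of X with [twoform c s], as a covector. *)
Definition contract2 c s X : 'rV[C]_m :=
  \sum_(i <- s) c i *: (dot (xi i) X *: eta i - dot (eta i) X *: xi i).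

(** A two-form has even degree, so contraction passes it without a sign. *)
Lemma contract_twoform c s X rho :
  contract X (wedge (twoform c s) rho) =
  wedge (covector (contract2 c s X)) rho + wedge (twoform c s) (contract X rho).
Proof.
rewrite /twoform /contract2; elim: s => [|i s IH].
  by rewrite !big_nil !wedge0f contract0 addr0 covector0 wedge0f.
rewrite !big_cons !wedgeDl contractD IH covectorD wedgeDl.
rewrite !wedgeZl contractZ -!wedgeA contract_covector contract_covector wedgeDr.
rewrite -!/(dot _ _) covectorZ -scaleNr covectorD !covectorZ wedgeZl wedgeDl !wedgeZl.
rewrite wedgefN !wedgeZr.
by apply/ffunP => S; rewrite !ffunE; ring.
Qed.

Lemma twoform_covector c s (zeta : 'rV[C]_m) rho :
  wedge (twoform c s) (wedge (covector zeta) rho) =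
  wedge (covector zeta) (wedge (twoform c s) rho).
Proof.
rewrite /twoform; elim: s => [|i s IH]; first by rewrite !big_nil !wedge0f wedgef0.
rewrite !big_cons !wedgeDl wedgeDr IH !wedgeZl wedgeZr -!wedgeA; congr (scale_form _ _ + _).
by rewrite (covectorC (eta i)) wedgefN (covectorC (xi i)) opprK.
Qed.

Lemma iter_twoform_covector c s n (zeta : 'rV[C]_m) rho :
  iter n (wedge (twoform c s)) (wedge (covector zeta) rho) =
  wedge (covector zeta) (iter n (wedge (twoform c s)) rho).
Proof. by elim: n => //= n ->; rewrite twoform_covector. Qed.

Lemma iter_wedge0 (a : form) n : iter n (wedge a) 0 = 0.
Proof. by elim: n => //= n ->; rewrite wedgef0. Qed.

Lemma contract_iter_twoform c s n X rho :
  contract X (iter n (wedge (twoform c s)) rho) =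
  scale_form n%:R (wedge (covector (contract2 c s X)) (iter n.-1 (wedge (twoform c s)) rho))
  + iter n (wedge (twoform c s)) (contract X rho).
Proof.
elim: n => [|n IH].
  by apply/ffunP => S; rewrite !ffunE mul0r add0r.
rewrite iterS contract_twoform IH wedgeDr wedgeZr twoform_covector addrA; congr (_ + _).
case: n {IH} => [|n] /=; apply/ffunP => S; rewrite !ffunE; first by ring.
by rewrite -natr1; ring.
Qed.

(** A filtration by degree in place of a grading: lower bounds suffice for the nilpotency of
    two-forms and for isolating the leading term of an exponential. *)
Definition vanish_below d rho := forall S : {set 'I_m}, (#|S| < d)%N -> rho S = 0.

Lemma vanish_below_wedge d e (a b : form) : vanish_below d a -> vanish_below e b ->
  vanish_below (d + e) (wedge a b).
Proof.
move=> Ha Hb S Sde; rewrite ffunE big1 // => U US.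
have [Ud|dU] := ltnP #|U| d; first by rewrite Ha // mulr0 mul0r.
rewrite Hb ?mulr0 //; have := cardsID U S; rewrite (setIidPr US) => E.
by rewrite -(ltn_add2l d) (leq_ltn_trans _ Sde) // -E leq_add2r.
Qed.

Lemma vanish_below_covector (zeta : 'rV[C]_m) : vanish_below 1 (covector zeta).
Proof.
move=> S; rewrite ltnS leqn0 cards_eq0 => /eqP ->; rewrite ffunE big1 // => j.
by rewrite eq_sym => /eqP/setP/(_ j); rewrite !inE eqxx.
Qed.

Lemma vanish_below_twoform c s : vanish_below 2 (twoform c s).
Proof.
move=> S S2; rewrite sum_ffunE big1_seq // => i _.
rewrite ffunE (@vanish_below_wedge 1 1) ?mulr0 //; exact: vanish_below_covector.
Qed.

Lemma iter_twoform_nilpotent c s rho : (0 < m)%N ->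
  iter m (wedge (twoform c s)) rho = 0.
Proof.
move=> m0; apply/ffunP => S; rewrite [RHS]ffunE.
have H n : vanish_below n.*2 (iter n (wedge (twoform c s)) rho).
  elim: n => // n IH /=; rewrite doubleS -add2n.
  exact: vanish_below_wedge (@vanish_below_twoform c s) IH.
apply: (H m); apply: leq_ltn_trans (max_card _) _.
by rewrite card_ord -addnn -[X in (X < _)%N]addn0 ltn_add2l.
Qed.

Lemma wpow_wedge (a rho : form) n : wedge (wpow a n) rho = iter n (wedge a) rho.
Proof. by elim: n => [|n IH] /=; rewrite ?wedge1f // -wedgeA IH. Qed.

Lemma wexp_wedge (a rho : form) : wedge (wexp a) rho =
  \sum_(k < m.+1) scale_form (k`!%:R)^-1 (iter k (wedge a) rho).
Proof.
have -> : wexp a = \sum_(k < m.+1) scale_form (k`!%:R)^-1 (wpow a k).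
  by apply/ffunP => S; rewrite ffunE sum_ffunE; apply: eq_bigr => k _; rewrite ffunE.
rewrite (big_morph (fun x => wedge x rho) (fun a b => wedgeDl a b rho) (wedge0f rho)).
by apply: eq_bigr => k _; rewrite wedgeZl wpow_wedge.
Qed.

(* Contraction acts on [exp a ^ Omega] as [e^a (i_X + (i_X a) ^)]. *)
Lemma cliff_wexp_eq0 c s X (zeta : 'rV[C]_m) Omega : (0 < m)%N ->
  contract X Omega = 0 ->
  wedge (covector (zeta + contract2 c s X)) Omega = 0 ->
  cliff X zeta (wedge (wexp (twoform c s)) Omega) = 0.
Proof.
move=> m0 H1 H2; rewrite /cliff wexp_wedge.
rewrite (big_morph _ (@contractD _ _ X) (contract0 X)).
rewrite (big_morph _ (fun a b => wedgeDr (covector zeta) a b) (wedgef0 _)).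
under eq_bigr => k _ do rewrite contractZ contract_iter_twoform H1 iter_wedge0 addr0 scale_formA.
(* The contraction term of exponent k + 1 is matched with the wedge term of exponent k. The
   contraction term of exponent 0 has coefficient 0, and the wedge term of exponent m vanishes by
   nilpotency. *)
rewrite big_ord_recl mulr0.
under [X in _ + X + _]eq_bigr => k _ do rewrite lift0 /=.
rewrite [X in _ + X]big_ord_recr /= iter_twoform_nilpotent // scale_form0 wedgef0 addr0.
rewrite (_ : scale_form 0 _ = 0) ?add0r; last by apply/ffunP => S; rewrite !ffunE mul0r.
rewrite -big_split big1 //= => k _.
rewrite wedgeZr factS natrM invfM mulrAC mulVf ?mul1r; last by rewrite pnatr_eq0.
rewrite -scale_formD -wedgeDl -covectorD -iter_twoform_covector addrC H2.
by rewrite iter_wedge0 scale_form0.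
Qed.

(** The exponential is 1 plus terms of degree at least 2, so the component of lowest degree of Omega
    survives: evaluate at a set S of least cardinal with Omega S nonzero. *)
Lemma wexp_wedge_neq0 c s Omega : Omega != 0 -> wedge (wexp (twoform c s)) Omega != 0.
Proof.
move=> Omega0.
have [S0 OS0] : exists S, Omega S != 0.
  apply/existsP; apply: contraNT Omega0; rewrite negb_exists => /forallP H.
  by apply/eqP/ffunP => S; rewrite ffunE; apply/eqP; have := H S; rewrite negbK.
case: (@arg_minnP _ S0 (fun S => Omega S != 0) (fun S : {set 'I_m} => #|S|) OS0) => S OS Smin.
apply: contraNneq OS => /ffunP/(_ S).
rewrite [RHS]ffunE ffunE (bigD1 set0) ?sub0set //= [X in _ + X]big1 ?addr0.
  rewrite setD0 wsign0s mul1r ffunE big_ord_recl /= ffunE cards0 big1 ?addr0.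
    by rewrite fact0 invr1 !mul1r => ->.
  move=> k _; rewrite (@vanish_below_wedge 2 0) ?mulr0 ?cards0 //.
  exact: vanish_below_twoform.
move=> U /andP[US U0].
have [->|/Smin] := eqVneq (Omega (S :\: U)) 0; first by rewrite mulr0.
have := cardsID U S; rewrite (setIidPr US) => <-.
by rewrite -[X in (_ <= X)%N -> _]add0n leq_add2r leqn0 cards_eq0 (negbTE U0).
Qed.

(** Induction on the number of pairs. Contracting the power of exponent n + 1 with X_i gives (n + 1)
    eta_i times the power of exponent n; the factor eta_i absorbs the i-th summand of the two-form,
    and contraction with Y_i then leaves the power for the remaining pairs. *)
Lemma iter_twoform_neq0 s (X Y : I -> 'rV[C]_m) rho : uniq s ->
  (forall i j, dot (xi i) (X j) = (i == j)%:R) ->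
  (forall i j, dot (eta i) (Y j) = (i == j)%:R) ->
  (forall i j, dot (xi i) (Y j) = 0) -> (forall i j, dot (eta i) (X j) = 0) ->
  (forall i, i \in s -> contract (X i) rho = 0 /\ contract (Y i) rho = 0) ->
  rho != 0 -> iter (size s) (wedge (twoform (fun=> 1) s)) rho != 0.
Proof.
move=> + xX eY xY eX + rho0; elim: s => //= i s IH /andP[ins us] H.
have {}IH : iter (size s) (wedge (twoform (fun=> 1) s)) rho != 0.
  by apply: IH => // j js; apply: H; rewrite inE js orbT.
have [HX HY] := H i (mem_head _ _).
have c2 (j : I) t : (forall k, k \in t -> k != i) ->
    contract2 (fun=> 1) t (X i) = 0 /\ contract2 (fun=> 1) t (Y i) = 0.
  move=> ti; split; rewrite /contract2 big1_seq // => k /andP[_ kt].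
    by rewrite xX eX (negbTE (ti _ kt)) !scale0r subrr scaler0.
  by rewrite xY eY (negbTE (ti _ kt)) !scale0r subrr scaler0.
have [sX sY] : contract2 (fun=> 1) s (X i) = 0 /\ contract2 (fun=> 1) s (Y i) = 0.
  by apply: c2 => // k ks; apply: contraNneq ins => <-.
have absorb n : wedge (covector (eta i)) (iter n (wedge (twoform (fun=> 1) (i :: s))) rho) =
    wedge (covector (eta i)) (iter n (wedge (twoform (fun=> 1) s)) rho).
  elim: n => //= n IHn; rewrite -!twoform_covector IHn [in LHS]/twoform big_cons wedgeDl.
  by rewrite wedgeZl -wedgeA covector_sq wedgef0 scale_form0 add0r.
apply: contraNneq IH => E; have := congr1 (contract (X i)) E.
rewrite -iterS contract_iter_twoform contract0 HX iter_wedge0 addr0.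
have -> : contract2 (fun=> 1) (i :: s) (X i) = eta i.
  by rewrite /contract2 big_cons -/(contract2 _ _ _) sX xX eX eqxx scale0r subr0 !scale1r addr0.
rewrite /= absorb => /(scale_form_eq0 _) /=; rewrite pnatr_eq0 => /(_ isT).
move=> /(congr1 (contract (Y i))); rewrite contract0 contract_covector -/(dot _ _) eY eqxx.
rewrite contract_iter_twoform HY iter_wedge0 addr0 sY.
rewrite covector0 wedge0f scale_form0 wedgef0 subr0 => /(scale_form_eq0 (oner_neq0 _)) ->.
exact: eqxx.
Qed.

End TwoForms.

(** * Canonical generators *)

Section Annihilator.
Import mathcomp.boot.fintype mathcomp.boot.finset.
Context {R : realType} {m : nat}.
Local Notation E := 'rV[R]_m.
Local Notation TT := (E * E)%type.
Local Notation form := {ffun {set 'I_m} -> R[i]}.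
Implicit Types (u v w : TT) (rho : form).

Lemma evE (xi v : E) : ev xi v = (xi *m v^T) 0 0.
Proof. by rewrite mxE; apply: eq_bigr => j _; rewrite mxE. Qed.

Lemma evDl (xi eta v : E) : ev (xi + eta) v = ev xi v + ev eta v.
Proof. by rewrite !evE mulmxDl mxE. Qed.

Lemma evDr (xi v w : E) : ev xi (v + w) = ev xi v + ev xi w.
Proof. by rewrite !evE linearD /= mulmxDr mxE. Qed.

Lemma evZl (c : R) (xi v : E) : ev (c *: xi) v = c * ev xi v.
Proof. by rewrite !evE -scalemxAl mxE. Qed.

Lemma evZr (c : R) (xi v : E) : ev xi (c *: v) = c * ev xi v.
Proof. by rewrite !evE linearZ /= -scalemxAr mxE. Qed.

Lemma evNl (xi v : E) : ev (- xi) v = - ev xi v.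
Proof. by rewrite -(scaleN1r xi) evZl mulN1r. Qed.

Lemma evNr (xi v : E) : ev xi (- v) = - ev xi v.
Proof. by rewrite -(scaleN1r v) evZr mulN1r. Qed.

Lemma pairingC u v : pairing u v = pairing v u.
Proof. by rewrite /pairing addrC. Qed.

Lemma pairingDl u v w : pairing (u + v) w = pairing u w + pairing v w.
Proof. rewrite /pairing /= evDl evDr; ring. Qed.

Lemma pairingZl c u w : pairing (c *: u) w = c * pairing u w.
Proof. rewrite /pairing /= evZl evZr; ring. Qed.

Lemma pairingNl u w : pairing (- u) w = - pairing u w.
Proof. by rewrite -scaleN1r pairingZl mulN1r. Qed.

Lemma pairingNr u w : pairing w (- u) = - pairing w u.
Proof. by rewrite pairingC pairingNl pairingC. Qed.

Lemma ev_delta (xi : E) j : ev xi (delta_mx 0 j) = xi 0 j.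
Proof.
rewrite /ev (bigD1 j) //= big1 ?addr0 => [|i ij]; first by rewrite mxE !eqxx mulr1.
by rewrite mxE (negbTE ij) andbF mulr0.
Qed.

Lemma evC (xi v : E) : ev xi v = ev v xi.
Proof. by apply: eq_bigr => j _; rewrite mulrC. Qed.

Lemma ev0l (v : E) : ev 0 v = 0.
Proof. by rewrite evE mul0mx mxE. Qed.

Lemma ev0r (v : E) : ev v 0 = 0.
Proof. by rewrite evC ev0l. Qed.

Lemma pairing_eq0 u : (forall v, pairing u v = 0) -> u = 0.
Proof.
move=> H; have two : (2^-1 : R) != 0 by rewrite invr_neq0 ?pnatr_eq0.
apply/pair_eqP/andP; split; apply/eqP/rowP => j; rewrite mxE.
  have := H (0, delta_mx 0 j); rewrite /pairing /= ev0r add0r evC ev_delta.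
  by move/eqP; rewrite mulf_eq0 (negbTE two) => /eqP.
have := H (delta_mx 0 j, 0); rewrite /pairing /= ev0l addr0 ev_delta.
by move/eqP; rewrite mulf_eq0 (negbTE two) => /eqP.
Qed.

Lemma cliffordE u v rho : clifford u v rho = cliff (cvec u.1 v.1) (cvec u.2 v.2) rho.
Proof. by []. Qed.

Lemma cvecD (a b c d : E) : cvec (a + c) (b + d) = cvec a b + cvec c d.
Proof. by apply/rowP => j; rewrite !mxE. Qed.

Lemma cliffordD u v u' v' rho :
  clifford (u + u') (v + v') rho = clifford u v rho + clifford u' v' rho.
Proof. by rewrite !cliffordE /= !cvecD cliffD. Qed.

Lemma Re_dot (a b c d : E) : complex.Re (dot (cvec a b) (cvec c d)) = ev a c - ev b d.
Proof.
rewrite /dot raddf_sum /= /ev -sumrB; apply: eq_bigr => j _; by rewrite !mxE.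
Qed.

(* The annihilator of a nonzero form is isotropic, and the i-eigenspace of an
   orthogonal J is maximal isotropic: one inclusion is enough. *)
Lemma canonical_generatorI (J : E -> TT -> TT) x rho :
  (forall (c : R) u v, J x (c *: u + v) = c *: J x u + J x v) ->
  (forall u v, pairing (J x u) (J x v) = pairing u v) ->
  (forall u, J x (J x u) = - u) ->
  rho != 0 -> (forall u, clifford u (- J x u) rho = 0) ->
  canonical_generator J x rho.
Proof.
move=> Jl Jo J2 rho0 H; split=> // a b; split=> [[Ja Jb]|ab0].
  by have := H a; rewrite Ja opprK.
have JD u v : J x (u + v) = J x u + J x v by rewrite -[u in LHS]scale1r Jl scale1r.
have J0 : J x 0 = 0 by have /eqP := JD 0 0; rewrite addr0 -[X in X == _]addr0 (inj_eq (addrI _)) => /eqP.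
have JN u : J x (- u) = - J x u by apply/eqP; rewrite -addr_eq0 -JD addNr J0.
(* Up to a factor 2, p + i q is the component of a + i b in the -i-eigenspace. The other component
   has the form u - i Ju with u = a + Jb and annihilates rho by hypothesis, so p + i q annihilates
   rho as well. *)
pose p := a - J x b; pose q := b + J x a.
have Jp : J x p = q by rewrite /p /q JD JN J2 opprK addrC.
have pq0 : clifford p q rho = 0.
  have := H (a + J x b); rewrite JD J2 => H1.
  have : clifford (p + (a + J x b)) (q + - (J x a - b)) rho = 0.
    rewrite (_ : p + _ = a + a); last by rewrite /p addrACA addNr addr0.
    rewrite (_ : q + _ = b + b); last by rewrite /q opprB addrACA subrr addr0.
    by rewrite cliffordD ab0 addr0.
  by rewrite cliffordD H1 addr0.
suff p0 : p = 0.
  have q0 : q = 0 by rewrite -Jp p0 J0.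
  split; apply/eqP; first by rewrite -addr_eq0 addrC; apply/eqP.
  by rewrite eq_sym -subr_eq0; apply/eqP.
apply: pairing_eq0 => v; move: p q Jp pq0 => p q Jp pq0.
(* Both p + i Jp and v - i Jv annihilate rho, so the scalar of the Clifford relation is 0. By
   orthogonality of J its real part is four times the pairing of p with v. *)
have := cliff_anticomm (cvec p.1 q.1) (cvec p.2 q.2) (cvec v.1 (- J x v).1) (cvec v.2 (- J x v).2) rho.
rewrite -!cliffordE pq0 H.
have cliff0 X xi : cliff X xi (0 : form) = 0 by rewrite /cliff contract0 wedgef0 addr0.
rewrite !cliffordE !cliff0 addr0 => /esym E0.
have := scale_form_eq0 _ E0; case: eqP => [d0 _|_ /(_ isT) r0]; last by rewrite r0 eqxx in rho0.
have := congr1 (@complex.Re R) d0; rewrite raddfD /= !Re_dot -Jp.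
have := Jo p v; rewrite /pairing /= => E1 E2.
apply: (@mulfI _ 4); rewrite ?pnatr_eq0 // mulr0.
rewrite /= evNr evNl in E2.
have {}E1 : ev (J x p).2 (J x v).1 + ev (J x v).2 (J x p).1 = ev p.2 v.1 + ev v.2 p.1.
  by apply: (@mulfI _ 2^-1); rewrite ?invr_neq0 ?pnatr_eq0.
transitivity (ev p.2 v.1 + ev v.2 p.1 + (ev p.2 v.1 + ev v.2 p.1)); first by rewrite /pairing; field.
rewrite -{2}E1 -E2; ring.
Qed.

Lemma opp1E (w : TT) i : (- w).1 0 i = - w.1 0 i.
Proof. by rewrite mxE. Qed.

Lemma opp2E (w : TT) i : (- w).2 0 i = - w.2 0 i.
Proof. by rewrite mxE. Qed.

End Annihilator.

(** * The model structure of type k in coordinates *)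

Section StandardStructure.
Import mathcomp.boot.fintype mathcomp.boot.finset.
Context {R : realType} {p : nat}.
Local Notation E := 'rV[R]_(p + p).
Local Notation TT := (E * E)%type.
Variables (k : nat) (b : 'I_p -> R).

(* In a coframe phi_1, ..., phi_p, psi_1, ..., psi_p, this is the structure with
   canonical generator
     exp (\sum_(j >= k) (b_j + i) phi_j /\ psi_j) /\ \prod_(j < k) (phi_j + i psi_j). *)
Definition stdJ (u : TT) : TT :=
  let y1 j := u.1 0 (lshift p j) in let y2 j := u.1 0 (rshift p j) in
  let h1 j := u.2 0 (lshift p j) in let h2 j := u.2 0 (rshift p j) in
  (row_mx (\row_j if (j < k)%N then y2 j else - b j * y1 j - h2 j)
          (\row_j if (j < k)%N then - y1 j else - b j * y2 j + h1 j),
   row_mx (\row_j if (j < k)%N then h2 j else b j * h1 j - (1 + b j ^+ 2) * y2 j)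
          (\row_j if (j < k)%N then - h1 j else b j * h2 j + (1 + b j ^+ 2) * y1 j)).

Lemma TT_eq (u v : TT) :
  (forall j, [/\ u.1 0 (lshift p j) = v.1 0 (lshift p j),
                 u.1 0 (rshift p j) = v.1 0 (rshift p j),
                 u.2 0 (lshift p j) = v.2 0 (lshift p j) &
                 u.2 0 (rshift p j) = v.2 0 (rshift p j)]) -> u = v.
Proof.
move=> H; apply/pair_eqP/andP; split; apply/eqP/rowP => i;
  by case: (split_ordP i) => j ->; have [] := H j.
Qed.

Lemma stdJE u j : [/\
  (stdJ u).1 0 (lshift p j) = (if (j < k)%N then u.1 0 (rshift p j)
     else - b j * u.1 0 (lshift p j) - u.2 0 (rshift p j)),
  (stdJ u).1 0 (rshift p j) = (if (j < k)%N then - u.1 0 (lshift p j)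
     else - b j * u.1 0 (rshift p j) + u.2 0 (lshift p j)),
  (stdJ u).2 0 (lshift p j) = (if (j < k)%N then u.2 0 (rshift p j)
     else b j * u.2 0 (lshift p j) - (1 + b j ^+ 2) * u.1 0 (rshift p j)) &
  (stdJ u).2 0 (rshift p j) = (if (j < k)%N then - u.2 0 (lshift p j)
     else b j * u.2 0 (rshift p j) + (1 + b j ^+ 2) * u.1 0 (lshift p j))].
Proof. by split; rewrite ?row_mxEl ?row_mxEr mxE. Qed.

Lemma stdJ_linear c u v : stdJ (c *: u + v) = c *: stdJ u + stdJ v.
Proof.
have lin1 (w w' : TT) i : (c *: w + w').1 0 i = c * w.1 0 i + w'.1 0 i by rewrite !mxE.
have lin2 (w w' : TT) i : (c *: w + w').2 0 i = c * w.2 0 i + w'.2 0 i by rewrite !mxE.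
apply: TT_eq => j; rewrite !lin1 !lin2.
have [-> -> -> ->] := stdJE u j; have [-> -> -> ->] := stdJE v j.
have [-> -> -> ->] := stdJE (c *: u + v) j; rewrite !lin1 !lin2.
by case: (j < k)%N; split; ring.
Qed.

Lemma stdJ_sq u : stdJ (stdJ u) = - u.
Proof.
apply: TT_eq => j; rewrite !opp1E !opp2E.
have [-> -> -> ->] := stdJE (stdJ u) j; have [-> -> -> ->] := stdJE u j.
by case: (j < k)%N; split; ring.
Qed.

Lemma stdJ_orthogonal u v : pairing (stdJ u) (stdJ v) = pairing u v.
Proof.
rewrite /pairing /ev !big_split_ord /= -!big_split /=; congr (_ * _); apply: eq_bigr => j _.
have [-> -> -> ->] := stdJE u j; have [-> -> -> ->] := stdJE v j.
by case: (j < k)%N; ring.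
Qed.

End StandardStructure.

(** * Coordinates with respect to a coframe *)

Section Frame.
Context {R : realType} {m : nat}.
Local Notation E := 'rV[R]_m.
Local Notation TT := (E * E)%type.
Implicit Types (P : 'M[R]_m) (u v : TT).

(* The rows of [P] are a basis of the cotangent space. *)
Definition frame_coord P u : TT := (u.1 *m P^T, u.2 *m invmx P).
Definition frame_vect P u : TT := (u.1 *m (invmx P)^T, u.2 *m P).

Lemma frame_coordK P : P \in unitmx -> cancel (frame_coord P) (frame_vect P).
Proof.
move=> Pu [y h]; rewrite /frame_vect /frame_coord /= -!mulmxA -trmx_mul.
by rewrite mulVmx // trmx1 !mulmx1.
Qed.

Lemma frame_vectK P : P \in unitmx -> cancel (frame_vect P) (frame_coord P).
Proof.
move=> Pu [y h]; rewrite /frame_vect /frame_coord /= -!mulmxA -trmx_mul.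
by rewrite mulmxV // trmx1 !mulmx1.
Qed.

Lemma frame_coord_linear P (c : R) u v :
  frame_coord P (c *: u + v) = c *: frame_coord P u + frame_coord P v.
Proof. by rewrite /frame_coord /= !mulmxDl -!scalemxAl. Qed.

Lemma frame_vect_linear P (c : R) u v :
  frame_vect P (c *: u + v) = c *: frame_vect P u + frame_vect P v.
Proof. by rewrite /frame_vect /= !mulmxDl -!scalemxAl. Qed.

Lemma frame_coordN P u : frame_coord P (- u) = - frame_coord P u.
Proof. by rewrite /frame_coord /= !mulNmx. Qed.

Lemma frame_vectN P u : frame_vect P (- u) = - frame_vect P u.
Proof. by rewrite /frame_vect /= !mulNmx. Qed.

Lemma frame_coord_pairing P u v : P \in unitmx ->
  pairing (frame_coord P u) (frame_coord P v) = pairing u v.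
Proof.
move=> Pu; have H (xi w : E) : ev (xi *m invmx P) (w *m P^T) = ev xi w.
  by rewrite !evE trmx_mul trmxK mulmxA -(mulmxA xi) mulVmx // mulmx1.
by rewrite /pairing /= !H.
Qed.

End Frame.

(** * Canonical generator and type of the model structure *)

Section StandardType.
Import mathcomp.boot.fintype mathcomp.boot.finset.
Context {R : realType} {p : nat}.
Local Notation C := R[i].
Local Notation E := 'rV[R]_(p + p).
Local Notation TT := (E * E)%type.
Variables (k : nat) (kp : (k <= p)%N) (b : 'I_p -> R).
Variables (P : 'M[R]_(p + p)) (Pu : P \in unitmx).

Let J (u : TT) := frame_vect P (stdJ k b (frame_coord P u)).
Let PC := map_mx (real_complex R) P.
Let QC := map_mx (real_complex R) (invmx P)^T.
Let phi j := row (lshift p j) PC.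
Let psi j := row (rshift p j) PC.
Let X j := row (lshift p j) QC.
Let Y j := row (rshift p j) QC.
Let s := [seq j : 'I_p <- enum 'I_p | (k <= j)%N].
Let theta (i : 'I_k) : 'rV[C]_(p + p) :=
  phi (widen_ord kp i) + 'i%C *: psi (widen_ord kp i).
Let r := index_enum 'I_k.

Local Lemma dotE (xi v : 'rV[C]_(p + p)) : dot xi v = (xi *m v^T) 0 0.
Proof. by rewrite mxE; apply: eq_bigr => j _; rewrite mxE. Qed.

Local Lemma dot_PQ i j : dot (row i PC) (row j QC) = (i == j)%:R.
Proof.
transitivity (real_complex R ((P *m invmx P) i j)).
  by rewrite mxE rmorph_sum; apply: eq_bigr => t _; rewrite !mxE rmorphM.
by rewrite mulmxV // mxE rmorph_nat.
Qed.

Local Lemma dot_phiX i j : dot (phi i) (X j) = (i == j)%:R.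
Proof. by rewrite dot_PQ (inj_eq (@lshift_inj _ _)). Qed.
Local Lemma dot_psiY i j : dot (psi i) (Y j) = (i == j)%:R.
Proof. by rewrite dot_PQ (inj_eq (@rshift_inj _ _)). Qed.
Local Lemma dot_phiY i j : dot (phi i) (Y j) = 0.
Proof. by rewrite dot_PQ eq_lrshift. Qed.
Local Lemma dot_psiX i j : dot (psi i) (X j) = 0.
Proof. by rewrite dot_PQ eq_rlshift. Qed.

Local Lemma dotDl (xi eta v : 'rV[C]_(p + p)) : dot (xi + eta) v = dot xi v + dot eta v.
Proof. by rewrite !dotE mulmxDl mxE. Qed.
Local Lemma dotZl (c : C) (xi v : 'rV[C]_(p + p)) : dot (c *: xi) v = c * dot xi v.
Proof. by rewrite !dotE -scalemxAl mxE. Qed.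
Local Lemma dotDr (xi v w : 'rV[C]_(p + p)) : dot xi (v + w) = dot xi v + dot xi w.
Proof. by rewrite !dotE linearD /= mulmxDr mxE. Qed.
Local Lemma dotZr (c : C) (xi v : 'rV[C]_(p + p)) : dot xi (c *: v) = c * dot xi v.
Proof. by rewrite !dotE linearZ /= -scalemxAr mxE. Qed.

Local Lemma dot_row (u v : TT) i :
  dot (row i PC) (cvec u.1 v.1) = ((frame_coord P u).1 0 i +i* (frame_coord P v).1 0 i)%C.
Proof.
rewrite /dot !mxE; apply/eqP; rewrite eq_complex !raddf_sum /=.
by apply/andP; split; apply/eqP/eq_bigr => j _; rewrite !mxE /=; ring.
Qed.

Let h1 (u v : TT) j : C :=
  ((frame_coord P u).2 0 (lshift p j) +i* (frame_coord P v).2 0 (lshift p j))%C.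
Let h2 (u v : TT) j : C :=
  ((frame_coord P u).2 0 (rshift p j) +i* (frame_coord P v).2 0 (rshift p j))%C.

Local Lemma cvec_sum (u v : TT) :
  cvec u.2 v.2 = \sum_j (h1 u v j *: phi j + h2 u v j *: psi j).
Proof.
have H (w : TT) t : w.2 0 t = \sum_i (frame_coord P w).2 0 i * P i t.
  by rewrite -[in LHS](frame_coordK Pu w) mxE.
apply/rowP => t; rewrite mxE !H /h1 /h2.
move: (frame_coord P u).2 (frame_coord P v).2 => y z; rewrite summxE !big_split_ord /= -!big_split /=.
apply/eqP; rewrite eq_complex !raddf_sum /=.
by apply/andP; split; apply/eqP/eq_bigr => j _; rewrite !mxE /=; ring.
Qed.

Local Lemma wprod_theta : wprod theta = wedges (map theta r) form1.
Proof. exact: wedges_big. Qed.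

Let thetab (i : 'I_k) := phi (widen_ord kp i) - 'i%C *: psi (widen_ord kp i).

Local Lemma conj_theta : map (map_mx (fun z : C => z^*%C)) (map theta r) = map thetab r.
Proof.
rewrite -map_comp; apply: eq_map => i /=; apply/rowP => t; rewrite !mxE.
by apply/eqP; rewrite eq_complex /=; apply/andP; split; apply/eqP; ring.
Qed.

Local Lemma size_s : size s = (p - k)%N.
Proof.
rewrite size_filter -(count_map val (fun j => k <= j)%N) val_enum_ord.
rewrite -[in iota _ _](subnKC kp) iotaD count_cat add0n.
rewrite (eq_in_count (a2 := pred0)) ?count_pred0 ?add0n; last first.
  by move=> j; rewrite mem_iota => /andP[_ jk] /=; rewrite leqNgt jk.
rewrite (eq_in_count (a2 := predT)) ?count_predT ?size_iota //.
by move=> j; rewrite mem_iota => /andP[kj _] /=; rewrite kj.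
Qed.

Local Lemma uniq_s : uniq s. Proof. by rewrite filter_uniq ?enum_uniq. Qed.

Let omega := twoform phi psi (fun=> 1) s.
Let B := twoform phi psi (fun j => (b j)%:C%C) s.

Local Lemma real_twoform (c : 'I_p -> R) : real_2form (twoform phi psi (fun j => (c j)%:C%C) s).
Proof.
have creal i : conj_form (covector (row i PC)) = covector (row i PC).
  apply/ffunP => S; rewrite !ffunE rmorph_sum; apply: eq_bigr => j _.
  by rewrite !mxE; apply/eqP; rewrite eq_complex /= oppr0 !eqxx.
move=> S; split.
  move=> S2; rewrite sum_ffunE big1 // => j _; rewrite !ffunE big1 ?mulr0 // => U US.
  have [U1|U1] := eqVneq #|U| 1%N; last first.
    rewrite [covector (phi j) U]ffunE big1 ?mulr0 ?mul0r // => t /eqP UE.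
    by rewrite UE cards1 in U1.
  rewrite [covector (psi j) _]ffunE big1 ?mulr0 // => t /eqP UE.
  by case: S2; rewrite -(cardsID U S) (setIidPr US) U1 UE cards1.
have : conj_form (twoform phi psi (fun j => (c j)%:C%C) s) = twoform phi psi (fun j => (c j)%:C%C) s.
  rewrite /twoform (big_morph conj_form (id1 := 0) (op1 := +%R)); last 2 first.
  - by move=> f g; apply/ffunP => T; rewrite !ffunE rmorphD.
  - by apply/ffunP => T; rewrite !ffunE rmorph0.
  apply: eq_bigr => j _; rewrite -[in RHS]creal -[X in _ = scale_form _ (wedge _ X)]creal.
  rewrite -conj_formM; apply/ffunP => T; rewrite !ffunE rmorphM /=; congr (_ * _).
  by apply/eqP; rewrite eq_complex /= oppr0 !eqxx.
move=> /ffunP/(_ S); rewrite ffunE; case: (twoform _ _ _ _ S) => x y /= [] /eqP.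
by rewrite eq_sym -addr_eq0 -mulr2n mulrn_eq0 /= => /eqP.
Qed.

Local Lemma B_omega : B + scale_form (0 +i* 1)%C omega = twoform phi psi (fun j => (b j +i* 1)%C) s.
Proof.
rewrite /B /omega /twoform (big_morph (scale_form (0 +i* 1)%C) (id1 := 0) (op1 := +%R)); last 2 first.
- exact: scale_formD.
- exact: scale_form0.
rewrite -big_split; apply: eq_bigr => j _ /=; rewrite scale_formA.
apply/ffunP => S; rewrite !ffunE -mulrDl; congr (_ * _).
by apply/eqP; rewrite eq_complex /=; apply/andP; split; apply/eqP; ring.
Qed.

(** The Boolean tag selects theta_j or its conjugate. With X_j, Y_j dual to phi_j, psi_j, the dual
    vectors of these complex covectors are (X_j - i Y_j) / 2 and (X_j + i Y_j) / 2. *)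
Local Lemma Omega_neq0 (t : seq (bool * 'I_k)) : uniq t ->
  wedges (map (fun x : bool * 'I_k => if x.1 then thetab x.2 else theta x.2) t) form1 != 0.
Proof.
move=> ut; pose Z (x : bool * 'I_k) := 2^-1 *: (X (widen_ord kp x.2)
   + (if x.1 then 'i%C else - 'i%C) *: Y (widen_ord kp x.2)).
have ii : 'i%C * 'i%C = -1 :> C by rewrite -expr2 sqr_i.
apply: (wedges_neq0 (Z := Z)) => // -[b1 i] [b2 j]; rewrite /Z /= xpair_eqE.
have wid : (widen_ord kp i == widen_ord kp j) = (i == j) by rewrite -!val_eqE.
have two : (2 : C) != 0 by rewrite pnatr_eq0.
rewrite dotZr dotDr dotZr; case: b1; rewrite /theta /thetab -?scaleNr !dotDl !dotZl.
  rewrite !dot_phiX !dot_psiX !dot_phiY !dot_psiY wid.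
  case: b2; case: (i == j) => /=; rewrite ?mulr0 ?mulr1 ?mul0r ?addr0 ?add0r ?mulr0 //.
    by rewrite mulrN ii opprK -[1 + 1]/2 mulVf.
  by rewrite mulrNN ii subrr mulr0.
rewrite !dot_phiX !dot_psiX !dot_phiY !dot_psiY wid.
case: b2; case: (i == j) => /=; rewrite ?mulr0 ?mulr1 ?mul0r ?addr0 ?add0r ?mulr0 //.
  by rewrite ii subrr mulr0.
by rewrite mulNr ii opprK -[1 + 1]/2 mulVf.
Qed.

Local Lemma wprod_theta_neq0 : wprod theta != 0.
Proof.
have := @Omega_neq0 [seq (false, i) | i <- r]; rewrite -map_comp wprod_theta; apply.
by rewrite map_inj_uniq ?index_enum_uniq // => i j [].
Qed.

(** The exponent is p - k, the number of pairs in omega. The dual vectors of these pairs contract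
    the product of the theta_j and their conjugates to 0, so the power of omega can be peeled off
    pair by pair. *)
Local Lemma volume_neq0 : wedge (wpow omega ((p + p)./2 - k))
  (wedge (wprod theta) (conj_form (wprod theta))) != 0.
Proof.
have -> : ((p + p)./2 - k = size s)%N by rewrite addnn doubleK size_s.
rewrite wpow_wedge wprod_theta conj_form_wedges conj_theta wedge_wedges wedge1f.
have wid j i : j \in s -> (widen_ord kp i == j) = false.
  rewrite mem_filter => /andP[kj _]; apply/negbTE; rewrite -val_eqE /=.
  by rewrite neq_ltn (leq_trans (ltn_ord i) kj).
apply: (iter_twoform_neq0 (X := X) (Y := Y)).
- exact: uniq_s.
- exact: dot_phiX.
- exact: dot_psiY.
- exact: dot_phiY.
- exact: dot_psiX.
- move=> j js; split; (apply: contract_wedges; last (apply: contract_wedges; last exact: contract1));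
    move=> _ /mapP[i _ ->]; rewrite /theta /thetab -?scaleNr dotDl dotZl;
    by rewrite ?dot_phiX ?dot_psiX ?dot_phiY ?dot_psiY wid // mulr0 addr0.
rewrite (_ : wedges _ _ = wedges (map (fun x : bool * 'I_k => if x.1 then thetab x.2 else theta x.2)
   ([seq (false, i) | i <- r] ++ [seq (true, i) | i <- r])) form1).
  have inj c : injective (fun i : 'I_k => (c, i) : bool * 'I_k) by move=> i j [].
  apply: Omega_neq0; rewrite cat_uniq !(map_inj_uniq (inj _)) index_enum_uniq.
  rewrite andbT /=; apply/hasPn => _ /mapP[i _ ->]; by apply/negP => /mapP[].
by rewrite map_cat -!map_comp /wedges foldr_cat.
Qed.

(** Write u - i Ju as X + zeta. Then X is killed by every theta_j, and zeta plus the contraction of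
    B + i omega with X is a combination of the theta_j; the exponential rule concludes. *)
Local Lemma clifford_stdJ (u : TT) : (0 < p)%N ->
  clifford u (- J u) (pure_form B omega theta) = 0.
Proof.
move=> p0; rewrite cliffordE /pure_form B_omega wprod_theta.
have E : frame_coord P (- J u) = - stdJ k b (frame_coord P u).
  by rewrite frame_coordN frame_vectK.
have dphi j : dot (phi j) (cvec u.1 (- J u).1) = ((frame_coord P u).1 0 (lshift p j)
    +i* (- (stdJ k b (frame_coord P u)).1 0 (lshift p j)))%C.
  by rewrite /phi dot_row E opp1E.
have dpsi j : dot (psi j) (cvec u.1 (- J u).1) = ((frame_coord P u).1 0 (rshift p j)
    +i* (- (stdJ k b (frame_coord P u)).1 0 (rshift p j)))%C.
  by rewrite /psi dot_row E opp1E.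
have eh1 j : h1 u (- J u) j = ((frame_coord P u).2 0 (lshift p j)
    +i* (- (stdJ k b (frame_coord P u)).2 0 (lshift p j)))%C.
  by rewrite /h1 E opp2E.
have eh2 j : h2 u (- J u) j = ((frame_coord P u).2 0 (rshift p j)
    +i* (- (stdJ k b (frame_coord P u)).2 0 (rshift p j)))%C.
  by rewrite /h2 E opp2E.
apply: cliff_wexp_eq0; first by rewrite addn_gt0 p0.
  apply: contract_wedges; rewrite ?contract1 // => _ /mapP[i _ ->]; rewrite /theta dotDl dotZl dphi dpsi.
  have [-> -> _ _] := stdJE k b (frame_coord P u) (widen_ord kp i); rewrite /= ltn_ord.
  by apply/eqP; rewrite eq_complex /=; apply/andP; split; apply/eqP; ring.
rewrite cvec_sum /contract2 big_filter big_enum_cond /= [X in _ + X]big_mkcond -big_split /=.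
apply: (big_ind (fun x => wedge (covector x) _ = 0)).
- by rewrite covector0 wedge0f.
- by move=> x y Hx Hy; rewrite covectorD wedgeDl Hx Hy addr0.
move=> j _; rewrite eh1 eh2 dphi dpsi.
have [-> -> -> ->] := stdJE k b (frame_coord P u) j.
move: ((frame_coord P u).1 0 (lshift p j)) ((frame_coord P u).1 0 (rshift p j)) => y1 y2.
move: ((frame_coord P u).2 0 (lshift p j)) ((frame_coord P u).2 0 (rshift p j)) => e1 e2.
case: leqP => [kj|jk].
  have regroup (x y c d e : C) (f g : 'rV[C]_(p + p)) :
      x *: f + y *: g + c *: (d *: g - e *: f) = (x - c * e) *: f + (y + c * d) *: g.
    by apply/rowP => t; rewrite !mxE; ring.
  rewrite regroup.
  rewrite [X in X *: phi j](_ : _ = 0) ?[X in X *: psi j](_ : _ = 0).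
  - by rewrite !scale0r addr0 covector0 wedge0f.
  - by apply/eqP; rewrite eq_complex /=; apply/andP; split; apply/eqP; ring.
  - by apply/eqP; rewrite eq_complex /=; apply/andP; split; apply/eqP; ring.
(* For j < k the two coefficients are e1 - i e2 and i (e1 - i e2): the contribution is a multiple of
   theta_j, which wedges to 0 with the product. For j >= k both coefficients vanish. *)
rewrite addr0 [X in X *: psi j](_ : _ = (e1 +i* - e2)%C * 'i%C); last first.
  by apply/eqP; rewrite eq_complex /=; apply/andP; split; apply/eqP; ring.
rewrite -scalerA -scalerDr covectorZ wedgeZl covector_wedges ?scale_form0 //.
apply/mapP; exists (Ordinal jk); first by rewrite mem_index_enum.
by rewrite /theta (_ : widen_ord kp _ = j) //; apply: val_inj.
Qed.

Lemma stdJ_type : (0 < p)%N ->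
  exists (B0 omega0 : {ffun {set 'I_(p + p)} -> C}) (theta0 : 'I_k -> 'rV[C]_(p + p)),
  [/\ real_2form B0, real_2form omega0,
      wedge (wpow omega0 ((p + p)./2 - k))
            (wedge (wprod theta0) (conj_form (wprod theta0))) != 0,
      pure_form B0 omega0 theta0 != 0 &
      forall u : TT, clifford u (- frame_vect P (stdJ k b (frame_coord P u)))
                       (pure_form B0 omega0 theta0) = 0].
Proof.
move=> p0; exists B, omega, theta; split.
- exact: real_twoform.
- exact: (real_twoform (fun=> 1)).
- exact: volume_neq0.
- by rewrite /pure_form B_omega wexp_wedge_neq0 ?wprod_theta_neq0.
- by move=> u; apply: clifford_stdJ.
Qed.

End StandardType.

(** * Smooth functions *)

Section Smooth.
Local Open Scope classical_set_scope.
Context {R : realType}.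

Lemma pair_row_sum_delta m (u : 'rV[R]_m * 'rV[R]_m) :
  u = \sum_i u.1 0 i *: (delta_mx 0 i, 0) + \sum_i u.2 0 i *: (0, delta_mx 0 i).
Proof.
rewrite [LHS]surjective_pairing; apply/pair_eqP/andP; split; apply/eqP.
  rewrite /= !raddf_sum /= [X in _ + X]big1 ?addr0 => [|i _]; last by rewrite scaler0.
  exact: row_sum_delta.
rewrite /= !raddf_sum /= [X in X + _]big1 ?add0r => [|i _]; last by rewrite scaler0.
exact: row_sum_delta.
Qed.

Section Generic.
Context {V : normedModType R}.

(** Bounding the number of derivatives allows induction on n in the product and quotient rules,
    where a derivative involves the function itself at the same order. *)
Definition smooth_upto (W : normedModType R) n (f : V -> W) := forall (s : seq V),
  (size s <= n)%N -> forall x,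
  differentiable (foldr (fun (v : V) (g : V -> W) => 'D_v g) f s) x.

Lemma smoothP (W : normedModType R) (f : V -> W) : smooth f <-> forall n, smooth_upto n f.
Proof.
split=> [H n s _ x|H s x]; first exact: H.
exact: (H (size s)).
Qed.

Lemma smooth_upto0 (W : normedModType R) (f : V -> W) :
  (forall x, differentiable f x) -> smooth_upto 0 f.
Proof. by move=> H s; rewrite leqn0 size_eq0 => /eqP -> x; exact: H. Qed.

(** [foldr] differentiates first in the last direction of the list, so that direction is the one to
    split off. *)
Lemma smooth_uptoS (W : normedModType R) n (f : V -> W) :
  smooth_upto n.+1 f <-> (forall x, differentiable f x) /\ forall v, smooth_upto n ('D_v f).
Proof.
split=> [H|[H0 H] s].
  split=> [x|v s sn x]; first exact: (H [::]).
  by have := H (rcons s v); rewrite size_rcons foldr_rcons; apply.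
case/lastP: s => [_ x|s v]; first exact: H0.
by rewrite size_rcons ltnS foldr_rcons => sn x; exact: H.
Qed.

Lemma smooth_upto_diff (W : normedModType R) n (f : V -> W) x :
  smooth_upto n f -> differentiable f x.
Proof. by move=> H; exact: (H [::]). Qed.

Lemma smooth_uptoW (W : normedModType R) n (f : V -> W) : smooth_upto n.+1 f -> smooth_upto n f.
Proof. by move=> H s sn; apply: H; exact: leqW. Qed.

Lemma smooth_upto_cst (W : normedModType R) n (w : W) : smooth_upto n (fun _ : V => w).
Proof.
elim: n w => [|n IH] w; first by apply: smooth_upto0 => x; exact: differentiable_cst.
apply/smooth_uptoS; split=> [x|v]; first exact: differentiable_cst.
rewrite (_ : 'D_v _ = fun=> 0); first exact: IH.
by apply/funext => x; exact: derive_cst.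
Qed.

Lemma smooth_uptoD (W : normedModType R) n (f g : V -> W) :
  smooth_upto n f -> smooth_upto n g -> smooth_upto n (fun x => f x + g x).
Proof.
elim: n f g => [|n IH] f g sf sg.
  by apply: smooth_upto0 => x; apply: differentiableD; [exact: smooth_upto_diff sf|exact: smooth_upto_diff sg].
apply/smooth_uptoS; move/smooth_uptoS: sf => [df sf]; move/smooth_uptoS: sg => [dg sg].
split=> [x|v]; first exact: differentiableD.
rewrite (_ : 'D_v _ = fun x => 'D_v f x + 'D_v g x); first exact: IH.
by apply/funext => x; apply: deriveD; exact: diff_derivable.
Qed.

Lemma smooth_upto_sum (W : normedModType R) n (I : Type) (r : seq I) (f : I -> V -> W) :
  (forall i, smooth_upto n (f i)) -> smooth_upto n (fun x => \sum_(i <- r) f i x).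
Proof.
move=> H; elim: r => [|i r IH].
  by under eq_fun do rewrite big_nil; exact: smooth_upto_cst.
by under eq_fun do rewrite big_cons; exact: smooth_uptoD.
Qed.

Lemma derive_scalel (W : normedModType R) (f : V -> R) (w : W) v x : differentiable f x ->
  'D_v (fun z => f z *: w) x = 'D_v f x *: w.
Proof.
move=> df; rewrite !deriveE //; last exact: differentiableZl.
by rewrite diffZl.
Qed.

Lemma smooth_uptoZl (W : normedModType R) n (f : V -> R) (w : W) :
  smooth_upto n f -> smooth_upto n (fun x => f x *: w).
Proof.
elim: n f => [|n IH] f sf.
  by apply: smooth_upto0 => x; apply: differentiableZl; exact: smooth_upto_diff sf.
apply/smooth_uptoS; move/smooth_uptoS: sf => [df sf].
split=> [x|v]; first exact: differentiableZl.
rewrite (_ : 'D_v _ = fun x => 'D_v f x *: w); first exact: IH.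
by apply/funext => x; exact: derive_scalel.
Qed.

Lemma smooth_uptoM n (f g : V -> R) :
  smooth_upto n f -> smooth_upto n g -> smooth_upto n (fun x => f x * g x).
Proof.
elim: n f g => [|n IH] f g sf sg.
  by apply: smooth_upto0 => x; apply: differentiableM; [exact: smooth_upto_diff sf|exact: smooth_upto_diff sg].
have sf' := smooth_uptoW sf; have sg' := smooth_uptoW sg.
apply/smooth_uptoS; move/smooth_uptoS: sf => [df sf]; move/smooth_uptoS: sg => [dg sg].
split=> [x|v]; first exact: differentiableM.
rewrite (_ : 'D_v _ = fun x => f x * 'D_v g x + g x * 'D_v f x).
  by apply: smooth_uptoD; apply: IH.
by apply/funext => x; apply: deriveM; exact: diff_derivable.
Qed.

Lemma smooth_upto_prod n (I : Type) (r : seq I) (f : I -> V -> R) :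
  (forall i, smooth_upto n (f i)) -> smooth_upto n (fun x => \prod_(i <- r) f i x).
Proof.
move=> H; elim: r => [|i r IH].
  by under eq_fun do rewrite big_nil; exact: smooth_upto_cst.
by under eq_fun do rewrite big_cons; exact: smooth_uptoM.
Qed.

Lemma smooth_uptoV n (f : V -> R) : (forall x, f x != 0) ->
  smooth_upto n f -> smooth_upto n (fun x => (f x)^-1).
Proof.
move=> f0; elim: n => [|n IH] sf.
  by apply: smooth_upto0 => x; apply: differentiableV => //; exact: smooth_upto_diff sf.
have sV := IH (smooth_uptoW sf).
apply/smooth_uptoS; move/smooth_uptoS: sf => [df sf].
split=> [x|v]; first exact: differentiableV.
rewrite (_ : 'D_v _ = fun x => - 1 * ((f x)^-1 * (f x)^-1 * 'D_v f x)).
  by apply: smooth_uptoM; [exact: smooth_upto_cst|apply: smooth_uptoM => //; exact: smooth_uptoM].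
apply/funext => x; rewrite deriveV //; last exact: diff_derivable.
by rewrite /GRing.scale /= expr2 invfM mulN1r mulNr.
Qed.

Lemma differentiable_entry a b (M : V -> 'M[R]_(a, b)) i j x : differentiable M x ->
  differentiable (fun y => M y i j) x.
Proof. by move=> dM; exact: (differentiable_comp dM (differentiable_coord _ _ _)). Qed.

Lemma derive_entry a b (M : V -> 'M[R]_(a, b)) i j v x : differentiable M x ->
  'D_v (fun y => M y i j) x = ('D_v M x) i j.
Proof. by move=> dM; rewrite derive_mx ?mxE //; exact: diff_derivable. Qed.

Lemma smooth_upto_entry n a b (M : V -> 'M[R]_(a, b)) i j :
  smooth_upto n M -> smooth_upto n (fun x => M x i j).
Proof.
elim: n M => [|n IH] M sM.
  by apply: smooth_upto0 => x; apply: differentiable_entry; exact: smooth_upto_diff sM.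
apply/smooth_uptoS; move/smooth_uptoS: sM => [dM sM].
split=> [x|v]; first exact: differentiable_entry.
rewrite (_ : 'D_v _ = fun x => ('D_v M x) i j); first exact: IH.
by apply/funext => x; exact: derive_entry.
Qed.

Lemma smooth_upto_det n a (M : V -> 'M[R]_a) :
  (forall i j, smooth_upto n (fun x => M x i j)) -> smooth_upto n (fun x => \det (M x)).
Proof.
move=> H; rewrite /determinant; apply: smooth_upto_sum => s.
by apply: smooth_uptoM; [exact: smooth_upto_cst|exact: smooth_upto_prod].
Qed.

(** Cramer's formula: the entries are cofactors divided by a determinant that never vanishes. *)
Lemma smooth_upto_invmx n a (M : V -> 'M[R]_a) i j : (forall x, M x \in unitmx) ->
  (forall i j, smooth_upto n (fun x => M x i j)) ->
  smooth_upto n (fun x => invmx (M x) i j).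
Proof.
move=> Mu H.
rewrite (_ : (fun x => _) = (fun x => (\det (M x))^-1 * ((-1) ^+ (j + i) *
   \det (row' j (col' i (M x)))))).
  apply: smooth_uptoM.
    apply: smooth_uptoV; last exact: smooth_upto_det.
    by move=> x; have := Mu x; rewrite unitmxE unitfE.
  apply: smooth_uptoM; first exact: smooth_upto_cst.
  apply: smooth_upto_det => k l.
  by rewrite (_ : (fun x => _) = (fun x => M x (lift j k) (lift i l))) //; apply/funext => x; rewrite !mxE.
by apply/funext => x; rewrite /invmx Mu !mxE.
Qed.

Lemma smooth_upto_pair n m (f : V -> 'rV[R]_m * 'rV[R]_m) :
  (forall i, smooth_upto n (fun x => (f x).1 0 i)) ->
  (forall i, smooth_upto n (fun x => (f x).2 0 i)) -> smooth_upto n f.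
Proof.
move=> H1 H2.
rewrite (_ : f = fun x => \sum_i (f x).1 0 i *: (delta_mx 0 i, 0) +
                         \sum_i (f x).2 0 i *: (0, delta_mx 0 i)).
  by apply: smooth_uptoD; apply: smooth_upto_sum => i; apply: smooth_uptoZl.
by apply/funext => x; exact: pair_row_sum_delta.
Qed.

End Generic.
End Smooth.

(** * The Courant bracket in a coframe *)

Section Derivatives.
Context {R : realType} {V : normedModType R}.

Lemma derive_bigsum (W : normedModType R) n (h : 'I_n -> V -> W) v x :
  (forall i, differentiable (h i) x) ->
  differentiable (fun y => \sum_i h i y) x /\
  'D_v (fun y => \sum_i h i y) x = \sum_i 'D_v (h i) x.
Proof.
move=> dh; rewrite (_ : (fun y => _) = \sum_i h i); last first.
  by apply/funext => y; rewrite fct_sumE.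
split; first exact: differentiable_sum.
by rewrite derive_sum // => i; exact: diff_derivable.
Qed.

Lemma derive_mul (f g : V -> R) v x : differentiable f x -> differentiable g x ->
  'D_v (fun y => f y * g y) x = 'D_v f x * g x + f x * 'D_v g x.
Proof.
move=> df dg; rewrite [LHS](@deriveM _ _ f g); try exact: diff_derivable.
by rewrite addrC [g x *: _]mulrC.
Qed.

Lemma derive_ev m (f X : V -> 'rV[R]_m) v x : differentiable f x -> differentiable X x ->
  differentiable (fun y => ev (f y) (X y)) x /\
  'D_v (fun y => ev (f y) (X y)) x = ev ('D_v f x) (X x) + ev (f x) ('D_v X x).
Proof.
move=> df dX.
have dM i : differentiable (fun y => f y 0 i * X y 0 i) x.
  by apply: differentiableM; exact: differentiable_entry.
have [d E] := derive_bigsum v dM; split=> //; rewrite [LHS]E /ev -big_split.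
apply: eq_bigr => i _ /=; rewrite derive_mul; try exact: differentiable_entry.
by rewrite !derive_entry.
Qed.

End Derivatives.

Section FrameBracket.
Context {R : realType} {m : nat}.
Local Notation E := 'rV[R]_m.
Local Notation TT := (E * E)%type.
Variables (f : 'I_m -> E -> E) (fs : forall i, smooth (f i)).
Let P x := \matrix_i f i x.
Hypothesis Pu : forall x, P x \in unitmx.
Variable c : 'I_m -> E -> E -> R.
Hypothesis fd : forall k x v w,
  ext_d (f k) x v w = c k (v *m (P x)^T) (w *m (P x)^T).

Let coord x (u : TT) := frame_coord (P x) u.

Lemma coord1E x u i : (coord x u).1 0 i = ev (f i x) u.1.
Proof.
rewrite mxE; apply: eq_bigr => j _; by rewrite !mxE mulrC.
Qed.

Lemma coord2E x u : u.2 = \sum_i (coord x u).2 0 i *: f i x.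
Proof.
rewrite -[in LHS](mulmxKV (Pu x) u.2) mulmx_sum_row; apply: eq_bigr => i _.
by rewrite rowK.
Qed.

(** Applied to the coordinates of a section, this is its derivative for the flat connection that
    makes the coframe parallel. *)
Definition dcoord (U : E -> TT) x v : TT :=
  (\row_i 'D_v (fun y => (U y).1 0 i) x, \row_i 'D_v (fun y => (U y).2 0 i) x).

Definition differentiable_coords (U : E -> TT) x := forall i,
  differentiable (fun y => (U y).1 0 i) x /\ differentiable (fun y => (U y).2 0 i) x.

Lemma differentiable_f i x : differentiable (f i) x.
Proof. exact: (fs i [::]). Qed.

Lemma section_differentiable (a : E -> TT) x : smooth a ->
  differentiable (fun y => (a y).1) x /\ differentiable (fun y => (a y).2) x.
Proof.
move=> sa; have da : differentiable a x by exact: (sa [::]).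
by split; apply: (differentiable_comp da); apply: linear_differentiable => y;
  [exact: cvg_fst|exact: cvg_snd].
Qed.

Lemma coord_differentiable (a : E -> TT) x : smooth a ->
  differentiable_coords (fun y => coord y (a y)) x.
Proof.
move=> sa i; have [d1 d2] := section_differentiable x sa; split.
  under eq_fun do rewrite coord1E.
  exact: (derive_ev 0 (differentiable_f i x) d1).1.
under eq_fun do rewrite mxE.
apply: (derive_bigsum 0 _).1 => j; apply: differentiableM.
  exact: differentiable_entry.
apply: (@smooth_upto_diff _ _ _ 0); apply: smooth_upto_invmx => //.
move=> k l; rewrite (_ : (fun x => _) = (fun x => f k x 0 l)).
  by apply: smooth_upto_entry; move/smoothP: (fs k); apply.
by apply/funext => y; rewrite mxE.
Qed.

(* Twice the pairing of [u, v] with w, for sections with constant coordinates. *)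
Definition structure_form (u v w : TT) : R :=
  \sum_k (v.2 0 k * c k u.1 w.1 - u.2 0 k * c k v.1 w.1 - w.2 0 k * c k u.1 v.1).

Lemma derive_dir (W : normedModType R) (X : E -> W) x (z : E) : differentiable X x ->
  'D_z X x = \sum_j z 0 j *: 'D_(delta_mx 0 j : E) X x.
Proof.
move=> dX; rewrite deriveE // [in LHS](row_sum_delta z) linear_sum.
by apply: eq_bigr => j _; rewrite linearZ deriveE.
Qed.

Lemma ev_suml (r : 'I_m -> R) (xi : 'I_m -> E) (v : E) :
  ev (\sum_k r k *: xi k) v = \sum_k r k * ev (xi k) v.
Proof.
rewrite (big_morph (fun xi => ev xi v) (fun a b => evDl a b v) (ev0l v)).
by apply: eq_bigr => k _; rewrite evZl.
Qed.

Lemma ev_coord x (u : TT) v : ev u.2 v = \sum_k (coord x u).2 0 k * ev (f k x) v.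
Proof. by rewrite [in LHS](coord2E x u) ev_suml. Qed.

Lemma ev_derive_vector (b : E -> TT) x v k : smooth b ->
  ev (f k x) ('D_v (fun y => (b y).1) x) =
  (dcoord (fun y => coord y (b y)) x v).1 0 k - ev ('D_v (f k) x) (b x).1.
Proof.
move=> sb; have [Y_d _] := section_differentiable x sb.
have [_ D] := derive_ev v (differentiable_f k x) Y_d.
rewrite /dcoord /= [X in _ = X - _]mxE.
rewrite (_ : (fun y => _) = (fun y => ev (f k y) (b y).1)); last first.
  by apply/funext => y; rewrite coord1E.
by rewrite D addrAC subrr add0r.
Qed.

Lemma ev_covector_derive (u : TT) (b : E -> TT) x v : smooth b ->
  ev u.2 ('D_v (fun y => (b y).1) x) =
  \sum_k (coord x u).2 0 k *
    ((dcoord (fun y => coord y (b y)) x v).1 0 k - ev ('D_v (f k) x) (b x).1).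
Proof.
by move=> sb; rewrite (ev_coord x); apply: eq_bigr => k _; rewrite ev_derive_vector.
Qed.

Lemma ev_derive_covector (b : E -> TT) x v z : smooth b ->
  ev ('D_v (fun y => (b y).2) x) z =
  \sum_k ((dcoord (fun y => coord y (b y)) x v).2 0 k * ev (f k x) z +
          (coord x (b x)).2 0 k * ev ('D_v (f k) x) z).
Proof.
move=> sb; have [_ eta_d] := section_differentiable x sb.
have dV := coord_differentiable x sb.
rewrite big_split /= -!ev_suml -evDl; congr ev; apply/rowP => j.
rewrite -derive_entry // mxE !summxE -big_split /=.
under eq_fun => y do rewrite (coord2E y (b y)) summxE.
have dM i : differentiable (fun y => ((coord y (b y)).2 0 i *: f i y) 0 j) x.
  under eq_fun do rewrite mxE.
  by apply: differentiableM; [have [] := dV i|apply: differentiable_entry; exact: differentiable_f].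
have [_ ->] := derive_bigsum v dM; apply: eq_bigr => i _.
under eq_fun do rewrite mxE.
rewrite derive_mul; [|by have [] := dV i|by apply: differentiable_entry; exact: differentiable_f].
rewrite (derive_entry 0 j v (differentiable_f i x)).
have zE (r : R) (u : E) : (r *: u) 0 j = r * u 0 j by rewrite mxE.
by rewrite !zE; congr (_ * _ + _); rewrite /dcoord mxE.
Qed.

Lemma ev_grad (g : E -> R) x z : differentiable g x -> ev (grad g x) z = 'D_z g x.
Proof.
by move=> dg; rewrite (derive_dir z dg); apply: eq_bigr => j _; rewrite mxE mulrC.
Qed.

Lemma ev_lie_form (X eta : E -> E) x z : differentiable X x ->
  ev (lie_form X eta x) z = ev ('D_(X x) eta x) z + ev (eta x) ('D_z X x).
Proof.
move=> dX; rewrite (derive_dir z dX).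
rewrite (big_morph (ev (eta x)) (fun a b => evDr _ a b) (ev0r _)) /ev -big_split.
apply: eq_bigr => j _ /=; rewrite mxE mulrDl; congr (_ + _).
by rewrite -/(ev _ _) -/(ev _ _) evZr mulrC.
Qed.

(** The algebra of the bracket formula, summand by summand. The letters t stand for the derivative
    of f_k along one vector evaluated on another; they survive only in antisymmetric combinations,
    which are values of df_k. *)
Local Lemma bracket_sums (x1 x2 x3 x4 x5 x6 x7 x8 : R)
    (u1 u2 v1 v2 w1 w2 dX1 dX2 dY1 dY2 dZu1 dZu2 dZv1 dZv2 tXZ tYZ tZX tZY tXY tYX : 'I_m -> R) :
  x1 = \sum_k (dX2 k * w1 k + v2 k * tXZ k) ->
  x2 = \sum_k v2 k * (dZu1 k - tZX k) ->
  x3 = \sum_k (dY2 k * w1 k + u2 k * tYZ k) ->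
  x4 = \sum_k u2 k * (dZv1 k - tZY k) ->
  x5 = \sum_k (dZv2 k * u1 k + v2 k * tZX k) ->
  x6 = \sum_k (dZu2 k * v1 k + u2 k * tZY k) ->
  x7 = \sum_k w2 k * (dX1 k - tXY k) ->
  x8 = \sum_k w2 k * (dY1 k - tYX k) ->
  x1 + x2 - (x3 + x4) - 2^-1 * (x5 + x2 - (x6 + x4)) + (x7 - x8) =
  2 * (2^-1 * \sum_k (dX2 k * w1 k + w2 k * dX1 k) - 2^-1 * \sum_k (dY2 k * w1 k + w2 k * dY1 k))
  + 2^-1 * \sum_k (dZu2 k * v1 k + v2 k * dZu1 k)
  - 2^-1 * \sum_k (dZv2 k * u1 k + u2 k * dZv1 k)
  + \sum_k (v2 k * (tXZ k - tZX k) - u2 k * (tYZ k - tZY k) - w2 k * (tXY k - tYX k)).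
Proof.
move=> -> -> -> -> -> -> -> ->.
have sD (F G : 'I_m -> R) : \sum_k F k + \sum_k G k = \sum_k (F k + G k).
  by rewrite big_split.
have sB (F G : 'I_m -> R) : \sum_k F k - \sum_k G k = \sum_k (F k - G k).
  by rewrite sumrB.
have sZ r (F : 'I_m -> R) : r * \sum_k F k = \sum_k r * F k by rewrite mulr_sumr.
rewrite !(sZ, sD, sB); apply: eq_bigr => k _.
by field.
Qed.

(** The bracket splits into a part with derivatives of the coordinates, in which the coframe behaves
    as a constant one, and an algebraic part made of the structure constants. *)
Lemma courant_coord (a b U V : E -> TT) x (w : TT) : smooth a -> smooth b ->
  (forall y, coord y (a y) = U y) -> (forall y, coord y (b y) = V y) ->
  2 * pairing (courant a b x) w =
  2 * pairing (dcoord V x (a x).1 - dcoord U x (b x).1) (coord x w)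
  + pairing (dcoord U x w.1) (V x) - pairing (U x) (dcoord V x w.1)
  + structure_form (U x) (V x) (coord x w).
Proof.
move=> sa sb /funext EU /funext EV; subst U V; pose U y := coord y (a y); pose V y := coord y (b y).
have [X_d xi_d] := section_differentiable x sa.
have [Y_d eta_d] := section_differentiable x sb.
have two : (2 : R) != 0 by rewrite pnatr_eq0.
have -> : 2 * pairing (courant a b x) w =
   ev (courant a b x).2 w.1 + ev w.2 (courant a b x).1.
  by rewrite /pairing mulrA divff // mul1r.
rewrite /courant /= !evDl !evNl evZl ev_grad; last first.
  by apply: differentiableB; apply: (derive_ev 0 _ _).1.
rewrite !ev_lie_form // /lie evDr evNr.
have -> : 'D_(w.1) (fun y => ev (b y).2 (a y).1 - ev (a y).2 (b y).1) x =
   ev ('D_(w.1) (fun y => (b y).2) x) (a x).1 + ev (b x).2 ('D_(w.1) (fun y => (a y).1) x)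
   - (ev ('D_(w.1) (fun y => (a y).2) x) (b x).1 + ev (a x).2 ('D_(w.1) (fun y => (b y).1) x)).
  rewrite [LHS](@deriveB _ _ _ (fun y => ev (b y).2 (a y).1) (fun y => ev (a y).2 (b y).1));
    try by apply: diff_derivable; apply: (derive_ev 0 _ _).1.
  by rewrite (derive_ev w.1 eta_d X_d).2 (derive_ev w.1 xi_d Y_d).2.
have c_eq (u v : TT) k : c k (coord x u).1 (coord x v).1 =
    ev ('D_(u.1) (f k) x) v.1 - ev ('D_(v.1) (f k) x) u.1 by rewrite -fd.
rewrite -/(U) -/(V).
have -> : structure_form (U x) (V x) (coord x w) = \sum_k
    ((V x).2 0 k * (ev ('D_(a x).1 (f k) x) w.1 - ev ('D_(w.1) (f k) x) (a x).1)
     - (U x).2 0 k * (ev ('D_(b x).1 (f k) x) w.1 - ev ('D_(w.1) (f k) x) (b x).1)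
     - (coord x w).2 0 k * (ev ('D_(a x).1 (f k) x) (b x).1 - ev ('D_(b x).1 (f k) x) (a x).1)).
  by apply: eq_bigr => k _; rewrite !c_eq.
have pairing_coord (d u : TT) : pairing d (coord x u) =
    2^-1 * \sum_k (d.2 0 k * ev (f k x) u.1 + (coord x u).2 0 k * d.1 0 k).
  rewrite /pairing; congr (_ * _); rewrite big_split; congr (_ + _).
  by apply: eq_bigr => k _; rewrite coord1E.
rewrite (pairingC (U x)) !pairingDl !pairingNl !pairing_coord.
exact: (bracket_sums (ev_derive_covector _ _ _ sb) (ev_covector_derive _ _ _ sa)
  (ev_derive_covector _ _ _ sa) (ev_covector_derive _ _ _ sb)
  (ev_derive_covector _ _ _ sb) (ev_derive_covector _ _ _ sa)
  (ev_covector_derive _ _ _ sb) (ev_covector_derive _ _ _ sa)).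
Qed.

Lemma TT_linear_entries (L : TT -> TT) :
  (forall (r : R) u w, L (r *: u + w) = r *: L u + L w) -> forall u j,
  (L u).1 0 j = \sum_i u.1 0 i * (L (delta_mx 0 i, 0)).1 0 j
              + \sum_i u.2 0 i * (L (0, delta_mx 0 i)).1 0 j /\
  (L u).2 0 j = \sum_i u.1 0 i * (L (delta_mx 0 i, 0)).2 0 j
              + \sum_i u.2 0 i * (L (0, delta_mx 0 i)).2 0 j.
Proof.
move=> Ll u j.
have LD v w : L (v + w) = L v + L w by rewrite -[v in LHS]scale1r Ll scale1r.
have L0 : L 0 = 0 by apply: (@addrI _ (L 0)); rewrite -LD !addr0.
have LZ r v : L (r *: v) = r *: L v by rewrite -[r *: v]addr0 Ll L0 addr0.
have -> : L u = \sum_i u.1 0 i *: L (delta_mx 0 i, 0) + \sum_i u.2 0 i *: L (0, delta_mx 0 i).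
  rewrite [in LHS](pair_row_sum_delta u) LD !(big_morph L LD L0).
  by congr (_ + _); apply: eq_bigr => i _; rewrite LZ.
split; rewrite mxE !raddf_sum !summxE;
  by congr (_ + _); apply: eq_bigr => i _; rewrite mxE.
Qed.

(** This is where the constancy of the structure in the coframe enters: a fixed linear map commutes
    with the derivative of coordinates. *)
Lemma dcoord_linear (L : TT -> TT) (U : E -> TT) x v :
  (forall (r : R) u w, L (r *: u + w) = r *: L u + L w) ->
  differentiable_coords U x -> dcoord (fun y => L (U y)) x v = L (dcoord U x v).
Proof.
move=> Ll dU.
have D (g1 g2 : 'I_m -> R) :
    'D_v (fun y => \sum_i (U y).1 0 i * g1 i + \sum_i (U y).2 0 i * g2 i) x =
    \sum_i 'D_v (fun y => (U y).1 0 i) x * g1 i + \sum_i 'D_v (fun y => (U y).2 0 i) x * g2 i.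
  have dM (g : 'I_m -> R) (W : E -> 'I_m -> R) : (forall i, differentiable (fun y => W y i) x) ->
      differentiable (fun y => \sum_i W y i * g i) x /\
      'D_v (fun y => \sum_i W y i * g i) x = \sum_i 'D_v (fun y => W y i) x * g i.
    move=> dW; have dWg i : differentiable (fun y => W y i * g i) x.
      by apply: differentiableM => //; exact: differentiable_cst.
    have [d ->] := derive_bigsum v dWg; split=> //; apply: eq_bigr => i _.
    rewrite (@derive_mul _ _ (fun y => W y i) (fun=> g i) v x (dW i) (differentiable_cst _ _)).
    by rewrite derive_cst mulr0 addr0.
  have [d1 e1] := dM g1 (fun y i => (U y).1 0 i) (fun i => (dU i).1).
  have [d2 e2] := dM g2 (fun y i => (U y).2 0 i) (fun i => (dU i).2).
  by rewrite [LHS](@deriveD _ _ _ (fun y => \sum_i _) (fun y => \sum_i _)) ?e1 ?e2 //;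
    exact: diff_derivable.
have Le := TT_linear_entries Ll.
apply/pair_eqP/andP; split; apply/eqP/rowP => j; rewrite [LHS]mxE.
  under eq_fun do rewrite (Le _ _).1.
  by rewrite D (Le _ _).1; congr (_ + _); apply: eq_bigr => i _; rewrite [in RHS]mxE.
under eq_fun do rewrite (Le _ _).2.
by rewrite D (Le _ _).2; congr (_ + _); apply: eq_bigr => i _; rewrite [in RHS]mxE.
Qed.

Variable J0 : TT -> TT.
Hypothesis J0_linear : forall (r : R) u v, J0 (r *: u + v) = r *: J0 u + J0 v.
Hypothesis J0_orthogonal : forall u v, pairing (J0 u) (J0 v) = pairing u v.
Hypothesis J0_sq : forall u, J0 (J0 u) = - u.
(** The imaginary part of T(u - i J0 u, v - i J0 v, w - i J0 w) = 0 for T the structure form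
    extended complex trilinearly. *)
Hypothesis J0_integrable : forall u v w,
  structure_form u v (J0 w) + structure_form u (J0 v) w + structure_form (J0 u) v w =
  structure_form (J0 u) (J0 v) (J0 w).
Hypothesis c_linear : forall k (r : R) y z w,
  c k (r *: y + z) w = r * c k y w + c k z w /\ c k w (r *: y + z) = r * c k w y + c k w z.

Definition frameJ x (u : TT) : TT := frame_vect (P x) (J0 (coord x u)).

Local Lemma coord_frameJ x u : coord x (frameJ x u) = J0 (coord x u).
Proof. by rewrite /coord frame_vectK. Qed.

Lemma frameJ_sq x u : frameJ x (frameJ x u) = - u.
Proof. by rewrite {1}/frameJ coord_frameJ J0_sq frame_vectN frame_coordK. Qed.

Lemma frameJ_linear x (r : R) u v : frameJ x (r *: u + v) = r *: frameJ x u + frameJ x v.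
Proof. by rewrite /frameJ /coord frame_coord_linear J0_linear frame_vect_linear. Qed.

Lemma frameJ_orthogonal x u v : pairing (frameJ x u) (frameJ x v) = pairing u v.
Proof.
by rewrite -(frame_coord_pairing _ _ (Pu x)) -!/(coord x _) !coord_frameJ J0_orthogonal frame_coord_pairing.
Qed.

Local Lemma J0N u : J0 (- u) = - J0 u.
Proof.
have J00 : J0 0 = 0.
  apply: (@addrI _ (J0 0)); rewrite -[X in X + _]scale1r -J0_linear; by rewrite scale1r !addr0.
by rewrite -[- u]addr0 -scaleN1r J0_linear J00 addr0 scaleN1r.
Qed.

Lemma pairing_J0 u v : pairing (J0 u) v = - pairing u (J0 v).
Proof. by rewrite -(J0_orthogonal u) J0_sq pairingNr opprK. Qed.

Local Lemma c0 k y : c k 0 y = 0 /\ c k y 0 = 0.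
Proof.
have [] := c_linear k 1 0 0 y; rewrite !scale1r !addr0 !mul1r => e1 e2.
by split; [apply: (@addrI _ (c k 0 y))|apply: (@addrI _ (c k y 0))]; rewrite addr0 -?e1 -?e2.
Qed.

Local Lemma cN k y z : c k (- y) z = - c k y z /\ c k z (- y) = - c k z y.
Proof.
have [] := c_linear k (-1) y 0 z; have [-> ->] := c0 k z.
by rewrite !scaleN1r !addr0 !mulN1r.
Qed.

Local Lemma structure_formN1 u v w : structure_form (- u) v w = - structure_form u v w.
Proof.
rewrite /structure_form -sumrN; apply: eq_bigr => k _.
by rewrite opp2E /= !(cN k _ _).1; ring.
Qed.

Local Lemma structure_formN2 u v w : structure_form u (- v) w = - structure_form u v w.
Proof.
rewrite /structure_form -sumrN; apply: eq_bigr => k _.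
by rewrite opp2E /= (cN k _ _).1 (cN k _ _).2; ring.
Qed.

(** Sections of L are determined by their real parts, b = - Ja and b' = - Ja', so everything is
    expressed by the coordinates U and V of a and a'. *)
Lemma frame_involutive (a b a' b' : E -> TT) : smooth a -> smooth b -> smooth a' -> smooth b' ->
  (forall x, eigenL frameJ x (a x) (b x)) -> (forall x, eigenL frameJ x (a' x) (b' x)) ->
  forall x, eigenL frameJ x (courant a a' x - courant b b' x)
                            (courant a b' x + courant b a' x).
Proof.
move=> sa sb sa' sb' Jab Jab' x.
pose U y := coord y (a y); pose V y := coord y (a' y).
have eU y : coord y (a y) = U y by [].
have eV y : coord y (a' y) = V y by [].
have eb y : coord y (b y) = - J0 (U y).
  by rewrite -coord_frameJ (Jab y).1 /coord frame_coordN opprK.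
have eb' y : coord y (b' y) = - J0 (V y).
  by rewrite -coord_frameJ (Jab' y).1 /coord frame_coordN opprK.
have NJ_linear (r : R) u v : - J0 (r *: u + v) = r *: - J0 u + - J0 v.
  by rewrite J0_linear opprD scalerN.
have dU v : dcoord (fun y => - J0 (U y)) x v = - J0 (dcoord U x v).
  exact: (dcoord_linear v NJ_linear (coord_differentiable x sa)).
have dV v : dcoord (fun y => - J0 (V y)) x v = - J0 (dcoord V x v).
  exact: (dcoord_linear v NJ_linear (coord_differentiable x sa')).
have frameJN u : frameJ x (- u) = - frameJ x u.
  by rewrite /frameJ /coord frame_coordN J0N frame_vectN.
(* Since J is skew for the nondegenerate pairing, p + i q lies in L as soon as pairing q with w
   amounts to pairing p with Jw for all w. *)
have reduce (p q : TT) : (forall w, 2 * pairing q w = 2 * pairing p (frameJ x w)) ->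
    eigenL frameJ x p q.
  move=> H; have Jp : frameJ x p = - q.
    apply/eqP; rewrite -addr_eq0; apply/eqP/pairing_eq0 => w.
    rewrite pairingDl -(frameJ_orthogonal x (frameJ x p)) frameJ_sq pairingNl.
    have two : (2 : R) != 0 by rewrite pnatr_eq0.
    by apply: (mulfI two); rewrite mulrDr H mulrN addNr mulr0.
  by split=> //; rewrite -[q]opprK -Jp frameJN frameJ_sq opprK.
apply: reduce => w.
have combine (p1 p2 p3 p4 x1 x2 x3 x4 : R) : 2 * p1 = x1 -> 2 * p2 = x2 -> 2 * p3 = x3 ->
    2 * p4 = x4 -> x3 + x4 = x1 - x2 -> 2 * (p3 + p4) = 2 * (p1 - p2).
  by move=> e1 e2 e3 e4; rewrite mulrDr mulrBr e1 e2 e3 e4.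
rewrite !pairingDl pairingNl.
have E1 := courant_coord x (frameJ x w) sa sa' eU eV.
have E2 := courant_coord x (frameJ x w) sb sb' eb eb'.
have E3 := courant_coord x w sa sb' eU eb'.
have E4 := courant_coord x w sb sa' eb eV.
apply: (combine _ _ _ _ _ _ _ _ E1 E2 E3 E4); move=> {E1 E2 E3 E4}.
rewrite !dU !dV coord_frameJ !(structure_formN1, structure_formN2).
move: (J0_integrable (U x) (V x) (coord x w)).
move: (dcoord V x _) (dcoord V x _) (dcoord V x _) (dcoord V x _) => v1 v2 v3 v4.
move: (dcoord U x _) (dcoord U x _) (dcoord U x _) (dcoord U x _) => u1 u2 u3 u4.
move: (U x) (V x) (coord x w) => u v w' T_eq.
rewrite !(pairingDl, pairingNl, pairingNr) !pairing_J0 !J0_sq !pairingNr.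
apply/eqP; rewrite -subr_eq0; apply/eqP.
move: T_eq => /eqP; rewrite -subr_eq0 => /eqP T_eq.
(* With J0 moved across the pairings, all terms with derivatives cancel and the trilinear identity
   remains, up to sign. *)
by rewrite -[RHS]oppr0 -T_eq; ring.
Qed.

(** A map that preserves the coframe preserves coordinates. Any endomorphism with constant
    coordinates is therefore invariant under it, and so descends to the quotient. *)
Lemma transports_coord phi x u u' :
  (forall i w, ev (f i (phi x)) ('d phi x w) = ev (f i x) w) ->
  transports phi x u u' <-> coord (phi x) u' = coord x u.
Proof.
move=> Hphi.
have ev2 v w : ev v.2 ('d phi x w) = \sum_i (coord (phi x) v).2 0 i * ev (f i x) w.
  by rewrite (ev_coord (phi x)); apply: eq_bigr => i _; rewrite Hphi.
split=> [[u1 u2]|E].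
  apply/pair_eqP/andP; split; apply/eqP/rowP => i; first by rewrite !coord1E u1 Hphi.
  suff E : u.2 = (coord (phi x) u').2 *m P x.
    by rewrite [in RHS]/coord /frame_coord /= E -mulmxA mulmxV // mulmx1.
  rewrite mulmx_sum_row; apply/rowP => j.
  rewrite -!ev_delta -u2 ev2 ev_suml; apply: eq_bigr => k _; by rewrite rowK.
split; last by move=> w; rewrite ev2 E -ev_coord.
have H i : ev (f i (phi x)) u'.1 = ev (f i (phi x)) ('d phi x u.1).
  by rewrite Hphi -!coord1E E.
have Pt_unit : (P (phi x))^T \in unitmx by rewrite unitmx_tr.
apply: (can_inj (mulmxK Pt_unit)); apply/rowP => i.
have rowE v : (v *m (P (phi x))^T) 0 i = ev (f i (phi x)) v := coord1E (phi x) (v, 0) i.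
by rewrite !rowE H.
Qed.

Lemma frameJ_smooth u : smooth (fun x => frameJ x u).
Proof.
have Ps n k l : smooth_upto n (fun x => P x k l).
  rewrite (_ : (fun x => _) = (fun x => f k x 0 l)); last by apply/funext => y; rewrite mxE.
  by apply: smooth_upto_entry; move/smoothP: (fs k); apply.
have Vs n k l : smooth_upto n (fun x => invmx (P x) k l) by apply: smooth_upto_invmx.
have c1 n i : smooth_upto n (fun x => (coord x u).1 0 i).
  under eq_fun do rewrite mxE; apply: smooth_upto_sum => j.
  apply: smooth_uptoM; first exact: smooth_upto_cst.
  by under eq_fun do rewrite mxE; exact: Ps.
have c2 n i : smooth_upto n (fun x => (coord x u).2 0 i).
  under eq_fun do rewrite mxE; apply: smooth_upto_sum => j.
  by apply: smooth_uptoM; first exact: smooth_upto_cst.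
have Le := TT_linear_entries J0_linear.
apply/smoothP => n; apply: smooth_upto_pair => i; under eq_fun do rewrite mxE;
  apply: smooth_upto_sum => j; apply: smooth_uptoM => //.
- under eq_fun do rewrite (Le _ _).1; apply: smooth_uptoD; apply: smooth_upto_sum => k;
    by apply: smooth_uptoM => //; exact: smooth_upto_cst.
- by under eq_fun do rewrite mxE; exact: Vs.
- under eq_fun do rewrite (Le _ _).2; apply: smooth_uptoD; apply: smooth_upto_sum => k;
    by apply: smooth_uptoM => //; exact: smooth_upto_cst.
Qed.

Lemma frame_generalized_complex (D : set (E -> E)) :
  (forall phi, D phi -> forall i x w, ev (f i (phi x)) ('d phi x w) = ev (f i x) w) ->
  generalized_complex D frameJ.
Proof.
move=> HD; split.
- exact: frameJ_linear.
- exact: frameJ_smooth.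
- move=> phi x u u' Dphi; rewrite !transports_coord; try by move=> i w; exact: HD.
  by rewrite !coord_frameJ => ->.
- exact: frameJ_orthogonal.
- exact: frameJ_sq.
- move=> a b a' b' [sa _] [sb _] [sa' _] [sb' _]; exact: frame_involutive.
Qed.

End FrameBracket.

(** * Left-invariant coframes *)

Section LeftInvariantCoframe.
Context {R : realType} {m : nat}.
Local Notation E := 'rV[R]_m.
Variable G : lie_group R m.

Lemma lg_mulr1 : right_id (lg_one G) (lg_mul G).
Proof.
move=> x; have mulVr y : lg_mul G y (lg_inv G y) = lg_one G.
  rewrite -[LHS](lg_mul1 G) -(lg_mulV G (lg_inv G y)) -lg_mulA.
  by rewrite (lg_mulA G (lg_inv G y)) lg_mulV lg_mul1.
by rewrite -(lg_mulV G x) lg_mulA mulVr lg_mul1.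
Qed.

(** Left invariance writes the matrix at the identity as the matrix at x times the transposed
    differential of the translation by x; an invertible product of square matrices has invertible
    factors. *)
Lemma left_invariant_coframe_unit (f : 'I_m -> E -> E) :
  (forall i, left_invariant G (f i)) -> (\matrix_i f i (lg_one G)) \in unitmx ->
  forall x, (\matrix_i f i x) \in unitmx.
Proof.
move=> fi P1 x.
suff E1 : \matrix_i f i (lg_one G) =
    (\matrix_i f i x) *m (lin1_mx ('d (lg_mul G x) (lg_one G)))^T.
  by move: P1; rewrite E1 unitmx_mul => /andP[].
apply/matrixP => i j; have [_ /(_ x (lg_one G) (delta_mx 0 j))] := fi i.
rewrite lg_mulr1 ev_delta => H; rewrite [LHS]mxE -H !mxE; apply: eq_bigr => k _.
by rewrite !mxE.
Qed.

End LeftInvariantCoframe.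

(** * From structure constants to a structure of type k on the quotient *)

Section StandardCoframe.
Context {R : realType} {p : nat}.
Local Notation E := 'rV[R]_(p + p).

Lemma standard_coframe_gcs (G : lie_group R (p + p)) (Gamma : set E)
    (f : 'I_(p + p) -> E -> E) (c : 'I_(p + p) -> E -> E -> R) (k : nat) (b : 'I_p -> R) :
  (0 < p)%N -> (k <= p)%N ->
  (forall i, left_invariant G (f i)) -> (\matrix_i f i (lg_one G)) \in unitmx ->
  (forall i (r : R) y z w, c i (r *: y + z) w = r * c i y w + c i z w /\
                           c i w (r *: y + z) = r * c i w y + c i w z) ->
  (forall i x v w, ext_d (f i) x v w =
     c i (v *m (\matrix_j f j x)^T) (w *m (\matrix_j f j x)^T)) ->
  (forall u v w, structure_form c u v (stdJ k b w) + structure_form c u (stdJ k b v) w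
     + structure_form c (stdJ k b u) v w =
     structure_form c (stdJ k b u) (stdJ k b v) (stdJ k b w)) ->
  exists J, generalized_complex (deck G Gamma) J /\ of_type J k.
Proof.
move=> p0 kp fi f1 cl fd T.
have Pu := left_invariant_coframe_unit fi f1.
have fs i : smooth (f i) := (fi i).1.
exists (frameJ f (stdJ k b)); split.
  apply: (frame_generalized_complex fs Pu fd).
  - exact: stdJ_linear.
  - exact: stdJ_orthogonal.
  - exact: stdJ_sq.
  - exact: T.
  - exact: cl.
  - by move=> _ [g _ <-] i x w; exact: (fi i).2.
move=> x; have [B [omega [theta [rB romega vol rho0 cliff]]]] := stdJ_type kp b (Pu x) p0.
exists B, omega, theta; split=> //; apply: canonical_generatorI => //.
- exact: (frameJ_linear _ (@stdJ_linear _ _ k b)).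
- exact: (frameJ_orthogonal Pu (@stdJ_orthogonal _ _ k b)).
- exact: (frameJ_sq Pu (@stdJ_sq _ _ k b)).
Qed.

End StandardCoframe.

(** * Linear combinations of left-invariant forms *)

Section LeftInvariantForms.
Context {R : realType} {m : nat}.
Local Notation E := 'rV[R]_m.
Variable G : lie_group R m.

Lemma smooth_linear_combination (V : normedModType R) (W : normedModType R) (r : R) (f g : V -> W) :
  smooth f -> smooth g -> smooth (fun x => r *: f x + g x).
Proof.
move=> /smoothP sf /smoothP sg; apply/smoothP => n; apply: smooth_uptoD => //.
elim: n f {g sg} sf => [|n IH] f sf.
  by apply: smooth_upto0 => x; apply: differentiableZ; exact: smooth_upto_diff (sf 0%N).
have df x : differentiable f x := smooth_upto_diff x (sf 0%N).
apply/smooth_uptoS; split=> [x|v]; first exact: differentiableZ.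
rewrite (_ : 'D_v _ = fun x => r *: 'D_v f x).
  by apply: IH => i; have /smooth_uptoS[] := sf i.+1.
by apply/funext => x; apply: deriveZ; exact: diff_derivable.
Qed.

Lemma left_invariant_linear (r : R) (f g : E -> E) :
  left_invariant G f -> left_invariant G g -> left_invariant G (fun x => r *: f x + g x).
Proof.
move=> [sf f_inv] [sg g_inv]; split; first exact: smooth_linear_combination.
by move=> h x w; rewrite !evDl !evZl f_inv g_inv.
Qed.

Lemma ext_d_linear (r : R) (f g : E -> E) x v w : smooth f -> smooth g ->
  ext_d (fun y => r *: f y + g y) x v w = r * ext_d f x v w + ext_d g x v w.
Proof.
move=> sf sg.
have df : differentiable f x by exact: (sf [::]).
have dg : differentiable g x by exact: (sg [::]).
have D u : 'D_u (fun y => r *: f y + g y) x = r *: 'D_u f x + 'D_u g x.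
  rewrite [LHS](@deriveD _ _ _ (fun y => r *: f y) g); try exact: diff_derivable.
    by congr (_ + _); apply: deriveZ; exact: diff_derivable.
  by apply: diff_derivable; exact: differentiableZ.
by rewrite /ext_d !D !evDl !evZl; ring.
Qed.

End LeftInvariantForms.

(** * The two coframes *)

Section StructureConstants.
Context {R : realType}.
Local Notation E := 'rV[R]_(4 + 4).
Local Notation TT := (E * E)%type.
Implicit Types (y z : E) (u v w : TT).

(** Coordinates become functions on [nat], so that structure constants are written with numerals and
    [ring] meets plain atoms. *)
Definition lft y i := y 0 (lshift 4 (inord i : 'I_4)).
Definition rgt y i := y 0 (rshift 4 (inord i : 'I_4)).

Implicit Types (a b c d : nat -> R).

(** The value of a wedge product of two coframe members: a and b hold their coordinates on the first
    vector, c and d those on the second. Thus [w2 a a c c] stands for phi /\ phi and [w2 a b c d]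
    for phi /\ psi. *)
Definition w2 a b c d i j : R := a i * d j - b j * c i.

(* dphi_j and dpsi_j in the coframe
   phi = (e1, e3 + 2 e5, e6, e8), psi = (s e2, -2 alpha s e4, e7 / s, e5 + r (e3 + 2 e5)),
   evaluated on two vectors whose coordinates are (a, b) and (c, d). *)
Definition dphiC r D A a b c d : seq R :=
  [:: 0; A * w2 a b c d 0%N 0%N; w2 a b c d 0%N 3%N - r * (w2 a a c c 0%N 1%N + w2 b b d d 0%N 1%N);
      w2 a a c c 0%N 2%N + w2 b b d d 0%N 2%N - D * w2 a b c d 1%N 1%N].
Definition dpsiC q B a b c d : seq R :=
  [:: 0; 0; w2 b b d d 0%N 3%N + q * (w2 a b c d 0%N 1%N + w2 a b c d 1%N 0%N); B * w2 a b c d 0%N 0%N].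

(* The same for phi = (e2, e1, e5 - e3 / (1 + alpha), -(3 + alpha) e4) and
   psi = (e3, e8, e7, e6). *)
Definition dphiS a b c d : seq R := [:: 0; 0; w2 a a c c 1%N 0%N; 0].
Definition dpsiS n mu nu la a b c d : seq R :=
  [:: 0; w2 a b c d 1%N 3%N + w2 a b c d 0%N 2%N + n * w2 a b c d 3%N 0%N + (1 - mu) * w2 a a c c 3%N 2%N;
      mu * w2 a a c c 1%N 3%N + la * w2 a a c c 0%N 2%N;
      w2 a a c c 1%N 2%N + n * w2 a b c d 1%N 0%N - nu * w2 a a c c 0%N 3%N].

Definition dframe (dphi dpsi : (nat -> R) -> (nat -> R) -> (nat -> R) -> (nat -> R) -> seq R)
    (k : 'I_(4 + 4)) y z : R :=
  match fintype.split k with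
  | inl j => (dphi (lft y) (rgt y) (lft z) (rgt z))`_j
  | inr j => (dpsi (lft y) (rgt y) (lft z) (rgt z))`_j
  end.

Lemma split_lshift4 j : fintype.split (lshift 4 j : 'I_(4 + 4)) = inl j.
Proof. exact: (unsplitK (inl j)). Qed.

Lemma split_rshift4 j : fintype.split (rshift 4 j : 'I_(4 + 4)) = inr j.
Proof. exact: (unsplitK (inr j)). Qed.

Lemma big_ord4 (F : 'I_4 -> R) :
  \sum_j F j = F (inord 0) + F (inord 1) + F (inord 2) + F (inord 3).
Proof.
rewrite !big_ord_recl big_ord0 addr0 !addrA.
by congr (F _ + F _ + F _ + F _); apply: val_inj; rewrite /= inordK.
Qed.

Section Trilinear.
Variables dphi dpsi : (nat -> R) -> (nat -> R) -> (nat -> R) -> (nat -> R) -> seq R.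

Definition trilinear (u1 u2 u3 u4 v1 v2 v3 v4 w1 w2 w3 w4 : nat -> R) : R :=
  let S i := v3 i * (dphi u1 u2 w1 w2)`_i - u3 i * (dphi v1 v2 w1 w2)`_i
             - w3 i * (dphi u1 u2 v1 v2)`_i
           + (v4 i * (dpsi u1 u2 w1 w2)`_i - u4 i * (dpsi v1 v2 w1 w2)`_i
             - w4 i * (dpsi u1 u2 v1 v2)`_i) in
  S 0%N + S 1%N + S 2%N + S 3%N.

Lemma structure_formE u v w : structure_form (dframe dphi dpsi) u v w =
  trilinear (lft u.1) (rgt u.1) (lft u.2) (rgt u.2) (lft v.1) (rgt v.1) (lft v.2) (rgt v.2)
            (lft w.1) (rgt w.1) (lft w.2) (rgt w.2).
Proof.
rewrite /structure_form big_split_ord /= !big_ord4 /dframe.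
rewrite !split_lshift4 !split_rshift4 !inordK // /trilinear /lft /rgt; ring.
Qed.

End Trilinear.

Variables (k : nat) (b : nat -> R).
Let bo (j : 'I_4) := b j.

Lemma coord_stdJ u : [/\
  lft (stdJ k bo u).1 = fun i => if ((inord i : 'I_4) < k)%N then rgt u.1 i
      else - bo (inord i) * lft u.1 i - rgt u.2 i,
  rgt (stdJ k bo u).1 = fun i => if ((inord i : 'I_4) < k)%N then - lft u.1 i
      else - bo (inord i) * rgt u.1 i + lft u.2 i,
  lft (stdJ k bo u).2 = fun i => if ((inord i : 'I_4) < k)%N then rgt u.2 i
      else bo (inord i) * lft u.2 i - (1 + bo (inord i) ^+ 2) * rgt u.1 i &
  rgt (stdJ k bo u).2 = fun i => if ((inord i : 'I_4) < k)%N then - lft u.2 i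
      else bo (inord i) * rgt u.2 i + (1 + bo (inord i) ^+ 2) * lft u.1 i].
Proof.
by split; apply/funext => i; rewrite /lft /rgt; have [e1 e2 e3 e4] := stdJE k bo u (inord i).
Qed.

End StructureConstants.

(** * The trilinear identity for the two coframes *)

Section Integrability.
Context {R : realType}.
Local Notation E := 'rV[R]_(4 + 4).
Local Notation TT := (E * E)%type.

Definition integrable_structure (dphi dpsi : (nat -> R) -> (nat -> R) -> (nat -> R) -> (nat -> R) -> seq R)
  (k : nat) (b : nat -> R) := forall u v w : TT,
  let c := dframe dphi dpsi in let J := stdJ k (fun j : 'I_4 => b j) in
  structure_form c u v (J w) + structure_form c u (J v) w + structure_form c (J u) v w =
  structure_form c (J u) (J v) (J w).

(** Only the shape of the derivatives matters: apart from theta_1 /\ psi_4 in dtheta_3, all terms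
    are of type (1, 1), whatever the five scalars. For k = 2, closure modulo theta_1 and theta_2
    reads b_3 + i = i (b_4 + i), whence b_3 = -1 and b_4 = 1. The list is indexed from 0, and only
    its entries of index at least k are read. *)
Lemma dC_integrable A B r q D k : (2 <= k <= 4)%N ->
  integrable_structure (dphiC r D A) (dpsiC q B) k (nth 0 [:: 0; 0; -1; 1]).
Proof.
move=> k24 u v w c J; rewrite !structure_formE.
have [-> -> -> ->] := coord_stdJ k (nth 0 [:: 0; 0; -1; 1]) u.
have [-> -> -> ->] := coord_stdJ k (nth 0 [:: 0; 0; -1; 1]) v.
have [-> -> -> ->] := coord_stdJ k (nth 0 [:: 0; 0; -1; 1]) w.
move: (lft u.1) (rgt u.1) (lft u.2) (rgt u.2) => u1 u2 u3 u4.
move: (lft v.1) (rgt v.1) (lft v.2) (rgt v.2) => v1 v2 v3 v4.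
move: (lft w.1) (rgt w.1) (lft w.2) (rgt w.2) => w1 w2' w3 w4.
case: k k24 J => [|[|[|[|[|k]]]]] // _ _;
  rewrite /trilinear /dphiC /dpsiC /w2 /= ?inordK //=; by ring.
Qed.

(** The coefficients n and mu recur in dpsi_2, dpsi_3 and dpsi_4 precisely so that the sum of the
    last three phi_j /\ psi_j is closed; the terms in la and nu disappear on wedging with phi_3 and
    phi_4. Hence the four scalars may be arbitrary. *)
Lemma dS_integrable n mu nu la k : (k <= 1)%N ->
  integrable_structure dphiS (dpsiS n mu nu la) k (fun=> 0).
Proof.
move=> k1 u v w c J; rewrite !structure_formE.
have [-> -> -> ->] := coord_stdJ k (fun=> 0) u.
have [-> -> -> ->] := coord_stdJ k (fun=> 0) v.
have [-> -> -> ->] := coord_stdJ k (fun=> 0) w.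
move: (lft u.1) (rgt u.1) (lft u.2) (rgt u.2) => u1 u2 u3 u4.
move: (lft v.1) (rgt v.1) (lft v.2) (rgt v.2) => v1 v2 v3 v4.
move: (lft w.1) (rgt w.1) (lft w.2) (rgt w.2) => w1 w2' w3 w4.
case: k k1 J => [|[|k]] // _ _;
  rewrite /trilinear /dphiS /dpsiS /w2 /= ?inordK //=; by ring.
Qed.

Lemma dframe_bilinear (dphi dpsi : (nat -> R) -> (nat -> R) -> (nat -> R) -> (nat -> R) -> seq R) :
  (forall j a b c d a' b' r, (dphi (fun i => r * a i + a' i) (fun i => r * b i + b' i) c d)`_j =
      r * (dphi a b c d)`_j + (dphi a' b' c d)`_j /\
      (dphi c d (fun i => r * a i + a' i) (fun i => r * b i + b' i))`_j =
      r * (dphi c d a b)`_j + (dphi c d a' b')`_j) ->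
  (forall j a b c d a' b' r, (dpsi (fun i => r * a i + a' i) (fun i => r * b i + b' i) c d)`_j =
      r * (dpsi a b c d)`_j + (dpsi a' b' c d)`_j /\
      (dpsi c d (fun i => r * a i + a' i) (fun i => r * b i + b' i))`_j =
      r * (dpsi c d a b)`_j + (dpsi c d a' b')`_j) ->
  forall k (r : R) (y z w : E),
  dframe dphi dpsi k (r *: y + z) w = r * dframe dphi dpsi k y w + dframe dphi dpsi k z w /\
  dframe dphi dpsi k w (r *: y + z) = r * dframe dphi dpsi k w y + dframe dphi dpsi k w z.
Proof.
move=> H1 H2 k r y z w; rewrite /dframe.
have -> : lft (r *: y + z) = fun i => r * lft y i + lft z i.
  by apply/funext => i; rewrite /lft !mxE.
have -> : rgt (r *: y + z) = fun i => r * rgt y i + rgt z i.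
  by apply/funext => i; rewrite /rgt !mxE.
by case: fintype.split => j; [exact: H1|exact: H2].
Qed.

Lemma dC_bilinear A B r q D k (t : R) (y z w : E) :
  dframe (dphiC r D A) (dpsiC q B) k (t *: y + z) w =
    t * dframe (dphiC r D A) (dpsiC q B) k y w + dframe (dphiC r D A) (dpsiC q B) k z w /\
  dframe (dphiC r D A) (dpsiC q B) k w (t *: y + z) =
    t * dframe (dphiC r D A) (dpsiC q B) k w y + dframe (dphiC r D A) (dpsiC q B) k w z.
Proof.
apply: dframe_bilinear => j a b c d a' b' t'; rewrite /dphiC /dpsiC /w2;
  by move: j => [|[|[|[|[|j]]]]] /=; split; ring.
Qed.

Lemma dS_bilinear n mu nu la k (t : R) (y z w : E) :
  dframe dphiS (dpsiS n mu nu la) k (t *: y + z) w =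
    t * dframe dphiS (dpsiS n mu nu la) k y w + dframe dphiS (dpsiS n mu nu la) k z w /\
  dframe dphiS (dpsiS n mu nu la) k w (t *: y + z) =
    t * dframe dphiS (dpsiS n mu nu la) k w y + dframe dphiS (dpsiS n mu nu la) k w z.
Proof.
apply: dframe_bilinear => j a b c d a' b' t'; rewrite /dphiS /dpsiS /w2;
  by move: j => [|[|[|[|[|j]]]]] /=; split; ring.
Qed.

End Integrability.

(** * Coframes that are linear combinations of the e^i *)

Section LinearCoframe.
Context {R : realType}.
Local Notation E := 'rV[R]_(4 + 4).
Variables (G : lie_group R (4 + 4)) (e : nat -> E -> E).
Hypothesis e_inv : forall i, (1 <= i <= 8)%N -> left_invariant G (e i).
Hypothesis e_free : row_free (\matrix_(i < 8) e i.+1 (lg_one G)).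

Implicit Types (l : seq (R * nat)).

Definition comb l (y : nat -> R) : R := \sum_(t <- l) t.1 * y t.2.
Definition form_comb l : E -> E := fun x => \sum_(t <- l) t.1 *: e t.2 x.

Lemma ev_form_comb l x v : ev (form_comb l x) v = comb l (fun i => ev (e i x) v).
Proof.
rewrite /form_comb (big_morph (fun xi => ev xi v) (fun a b => evDl a b v) (ev0l v)).
by apply: eq_bigr => t _; rewrite evZl.
Qed.

Lemma form_comb_cons t l : form_comb (t :: l) = fun x => t.1 *: e t.2 x + form_comb l x.
Proof. by apply/funext => x; rewrite /form_comb big_cons. Qed.

Lemma form_comb_inv l : all (fun t => 1 <= t.2 <= 8)%N l -> left_invariant G (form_comb l).
Proof.
elim: l => [_|t l IH /= /andP[t8 l8]].
  have -> : form_comb [::] = fun=> 0 by apply/funext => x; rewrite /form_comb big_nil.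
  split; last by move=> g x w; rewrite !ev0l.
  by apply/smoothP => n; exact: smooth_upto_cst.
by rewrite form_comb_cons; apply: left_invariant_linear; [exact: e_inv|exact: IH].
Qed.

Lemma ext_d_form_comb l x v w : all (fun t => 1 <= t.2 <= 8)%N l ->
  ext_d (form_comb l) x v w = comb l (fun i => ext_d (e i) x v w).
Proof.
elim: l => [_|t l IH /= /andP[t8 l8]].
  have -> : form_comb [::] = fun=> 0 by apply/funext => y; rewrite /form_comb big_nil.
  by rewrite /comb big_nil /ext_d !(derive_cst 0) !ev0l subrr.
rewrite form_comb_cons ext_d_linear; last 2 first.
  exact: (e_inv t8).1.
  exact: (form_comb_inv l8).1.
by rewrite IH // /comb big_cons.
Qed.

Variables (lphi lpsi : seq (seq (R * nat))).

Definition lcoframe (i : 'I_(4 + 4)) : E -> E := form_comb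
  match fintype.split i with inl j => nth [::] lphi j | inr j => nth [::] lpsi j end.

Lemma lcoframe_coords x v :
  lft (v *m (\matrix_j lcoframe j x)^T) =
    (fun i => comb (nth [::] lphi (inord i : 'I_4)) (fun k => ev (e k x) v)) /\
  rgt (v *m (\matrix_j lcoframe j x)^T) =
    (fun i => comb (nth [::] lpsi (inord i : 'I_4)) (fun k => ev (e k x) v)).
Proof.
have H i : (v *m (\matrix_j lcoframe j x)^T) 0 i = ev (lcoframe i x) v.
  by rewrite mxE; apply: eq_bigr => j _; rewrite !mxE mulrC.
by split; apply/funext => i; rewrite /lft /rgt H /lcoframe ?split_lshift4 ?split_rshift4 ev_form_comb.
Qed.

(** The rows e_q span the whole space, so it suffices to recover each of them from the coframe. Two
    members are enough, because only e3 and e5 get mixed; where one is enough, the other has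
    coefficient 0. *)
Lemma lcoframe_unit :
  (forall q : nat, (q < 8)%N -> exists (c d : bool) (i j : 'I_4) (r t : R), forall x,
    e q.+1 x = r *: form_comb (nth [::] (if c then lpsi else lphi) i) x
             + t *: form_comb (nth [::] (if d then lpsi else lphi) j) x) ->
  (\matrix_j lcoframe j (lg_one G)) \in unitmx.
Proof.
move=> H; rewrite -row_full_unit -sub1mx; apply: submx_trans (_ : (\matrix_(i < 8) e i.+1 (lg_one G)  <= _)%MS).
  by rewrite sub1mx row_full_unit -row_free_unit.
apply/row_subP => l; have [c [d [a [b [r [t El]]]]]] := H l (ltn_ord l).
have S i : (lcoframe i (lg_one G) <= \matrix_j lcoframe j (lg_one G))%MS.
  by rewrite -[X in (X <= _)%MS](rowK (fun j => lcoframe j (lg_one G))) row_sub.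
have S' (g : bool) (j : 'I_4) : (form_comb (nth [::] (if g then lpsi else lphi) j) (lg_one G)
    <= \matrix_j lcoframe j (lg_one G))%MS.
  by case: g; [have := S (rshift 4 j)|have := S (lshift 4 j)]; rewrite /lcoframe ?split_lshift4 ?split_rshift4.
by rewrite rowK El; apply: addmx_sub; apply: scalemx_sub.
Qed.

Definition ce_d (al : R) (i : nat) (y z : nat -> R) : R :=
  let w (i j : nat) := y i * z j - y j * z i in
  match i with
  | 5%N => w 1%N 2%N
  | 6%N => w 1%N 5%N + (1 - al) * w 2%N 4%N
  | 7%N => - (1 + al) * w 1%N 4%N - w 2%N 3%N + (1 + al) * w 2%N 5%N
  | 8%N => w 1%N 6%N + w 2%N 7%N + w 3%N 4%N - 2 * w 4%N 5%N
  | _ => 0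
  end.

(** All the geometry is discharged here: for an explicit coframe there remain its inversion, the
    comparison of its differentials with the structure constants, and the polynomial identities of
    bilinearity and integrability. *)
Lemma lcoframe_gcs (al : R) Gamma k b dphi dpsi :
  (k <= 4)%N ->
  (forall i x v w, (1 <= i <= 8)%N ->
     ext_d (e i) x v w = ce_d al i (fun j => ev (e j x) v) (fun j => ev (e j x) w)) ->
  (forall q : nat, (q < 8)%N -> exists (c d : bool) (i j : 'I_4) (r t : R), forall x,
    e q.+1 x = r *: form_comb (nth [::] (if c then lpsi else lphi) i) x
             + t *: form_comb (nth [::] (if d then lpsi else lphi) j) x) ->
  all (all (fun t => 1 <= t.2 <= 8)%N) lphi -> all (all (fun t => 1 <= t.2 <= 8)%N) lpsi ->
  integrable_structure dphi dpsi k b ->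
  (forall i (t : R) y z w,
     dframe dphi dpsi i (t *: y + z) w = t * dframe dphi dpsi i y w + dframe dphi dpsi i z w /\
     dframe dphi dpsi i w (t *: y + z) = t * dframe dphi dpsi i w y + dframe dphi dpsi i w z) ->
  (forall (j : 'I_4) y z,
    let yphi i := comb (nth [::] lphi (inord i : 'I_4)) y in
    let ypsi i := comb (nth [::] lpsi (inord i : 'I_4)) y in
    let zphi i := comb (nth [::] lphi (inord i : 'I_4)) z in
    let zpsi i := comb (nth [::] lpsi (inord i : 'I_4)) z in
    comb (nth [::] lphi j) (fun i => ce_d al i y z) = (dphi yphi ypsi zphi zpsi)`_j /\
    comb (nth [::] lpsi j) (fun i => ce_d al i y z) = (dpsi yphi ypsi zphi zpsi)`_j) ->
  exists J, generalized_complex (deck G Gamma) J /\ of_type J k.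
Proof.
move=> k4 de He l1 l2 T bil deq.
have nth_all (ll : seq (seq (R * nat))) j : all (all (fun t => 1 <= t.2 <= 8)%N) ll ->
    all (fun t => 1 <= t.2 <= 8)%N (nth [::] ll j).
  by move=> /all_nthP H; case: (ltnP j (size ll)) => ?; [exact: H|rewrite nth_default].
apply: (standard_coframe_gcs Gamma _ k4 _ (lcoframe_unit He) bil _ T) => //.
  by move=> i; apply: form_comb_inv; case: fintype.split => j; exact: nth_all.
move=> i x v w; rewrite /dframe.
have [-> ->] := lcoframe_coords x v; have [-> ->] := lcoframe_coords x w.
have ext_comb l : all (fun t => 1 <= t.2 <= 8)%N l -> ext_d (form_comb l) x v w =
    comb l (fun i => ce_d al i (fun j => ev (e j x) v) (fun j => ev (e j x) w)).
  move=> l8; rewrite ext_d_form_comb //; apply: eq_big_seq => t tl.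
  by rewrite de //; exact: (allP l8).
rewrite /lcoframe; case: fintype.split => j; rewrite ext_comb ?nth_all //;
  by have [? ?] := deq j (fun j => ev (e j x) v) (fun j => ev (e j x) w).
Qed.

End LinearCoframe.

Theorem proposition1p2 (R : realType) (alpha : rat) (halpha : 0 < alpha)
    (G : lie_group R 8) (hG : has_lie_algebra_g alpha G)
    (Gamma : set 'rV[R]_8) (hGamma : lattice G Gamma)
    (k : nat) (hk : (0 <= k <= 4)%N) :
  exists J : 'rV[R]_8 -> 'rV[R]_8 * 'rV[R]_8 -> 'rV[R]_8 * 'rV[R]_8,
    generalized_complex (deck G Gamma) J /\ of_type J k.
Proof.
case: hG => e [e_inv e_free de14 de58].
have al0 : 0 < ratr alpha :> R by rewrite ltr0q.
move: (ratr alpha : R) al0 de58 => al al0 de58.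
have de i x v w : (1 <= i <= 8)%N ->
    ext_d (e i) x v w = ce_d al i (fun j => ev (e j x) v) (fun j => ev (e j x) w).
  move=> i18; have [d5 d6 d7 d8] := de58 x v w.
  have wE a b : wedge1 (e a) (e b) x v w =
      ev (e a x) v * ev (e b x) w - ev (e b x) v * ev (e a x) w.
    by rewrite /wedge1 [X in _ - X]mulrC.
  case: i i18 => [|[|[|[|[|[|[|[|[|i]]]]]]]]] // _; rewrite /ce_d;
    [exact: de14|exact: de14|exact: de14|exact: de14| | | |].
  - by rewrite d5 wE.
  - by rewrite d6 !wE.
  - by rewrite d7 !wE.
  - by rewrite d8 !wE.
have combE := (big_cons, big_nil, addr0).
have [k1|k2] := leqP k 1.
  have nz1 : 1 + al != 0 by rewrite gt_eqF // addr_gt0.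
  have nz3 : 3 + al != 0 by rewrite gt_eqF // addr_gt0.
  (* In d(e18 + e57) the terms e127 cancel, and -e134 + e235 + (3 + alpha) e145 is left. As d(e37) =
     (1 + alpha) (e235 - e134) and d(e46) = e145, subtracting e37 / (1 + alpha) and (3 + alpha) e46
     gives a closed form. *)
  pose lphi : seq (seq (R * nat)) :=
    [:: [:: (1, 2%N)]; [:: (1, 1%N)]; [:: (1, 5%N); (- (1 + al)^-1, 3%N)]; [:: (- (3 + al), 4%N)]].
  pose lpsi : seq (seq (R * nat)) := [:: [:: (1, 3%N)]; [:: (1, 8%N)]; [:: (1, 7%N)]; [:: (1, 6%N)]].
  apply: (@lcoframe_gcs _ G e e_inv e_free lphi lpsi al Gamma k (fun=> 0) dphiS
    (dpsiS (1 + al)^-1 ((1 + al) / (3 + al)) ((1 - al) / (3 + al)) (1 + al))) => //.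
  - have fc1 (a : nat) x : form_comb e [:: (1 : R, a)] x = e a x.
      by rewrite /form_comb big_seq1 scale1r.
    pose o i : 'I_4 := inord i.
    case=> [|[|[|[|[|[|[|[|l]]]]]]]] // _.
    + exists false, false, (o 1), (o 0), 1, 0 => x; rewrite !inordK //=.
      by rewrite /lphi /lpsi /= !fc1 scale1r scale0r addr0.
    + exists false, false, (o 0), (o 0), 1, 0 => x; rewrite !inordK //=.
      by rewrite !fc1 scale1r scale0r addr0.
    + exists true, false, (o 0), (o 0), 1, 0 => x; rewrite !inordK //=.
      by rewrite !fc1 scale1r scale0r addr0.
    + exists false, false, (o 3), (o 0), (- (3 + al)^-1), 0 => x; rewrite !inordK //=.
      by rewrite scale0r addr0 /form_comb big_seq1 scalerA mulrNN mulVf // scale1r.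
    + exists false, true, (o 2), (o 0), 1, (1 + al)^-1 => x; rewrite !inordK //=.
      by rewrite fc1 /form_comb !combE !scale1r scaleNr subrK.
    + exists true, false, (o 3), (o 0), 1, 0 => x; rewrite !inordK //=.
      by rewrite !fc1 scale1r scale0r addr0.
    + exists true, false, (o 2), (o 0), 1, 0 => x; rewrite !inordK //=.
      by rewrite !fc1 scale1r scale0r addr0.
    + exists true, false, (o 1), (o 0), 1, 0 => x; rewrite !inordK //=.
      by rewrite !fc1 scale1r scale0r addr0.
  - exact: dS_integrable.
  - exact: dS_bilinear.
  - move=> j y z; rewrite /comb /dphiS /dpsiS /w2.
    case: j => [[|[|[|[|j]]]] hj] //=; rewrite ?inordK //= !combE /ce_d /=; split; field; by rewrite ?nz1 ?nz3.
(* Here t is the scalar s of the overview. Replacing alpha by t^2 - 3 makes t the only parameter, so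
   [field] needs no relation between the two. *)
have [t [t0 tE]] : exists t : R, t != 0 /\ al = t ^+ 2 - 3.
  exists (Num.sqrt (3 + al)); split; first by rewrite sqrtr_eq0 -ltNge addr_gt0.
  by rewrite sqr_sqrtr ?addr_ge0 ?ler0n ?ltW // addrAC subrr add0r.
have nz : t ^+ 2 - 3 != 0 by rewrite -tE gt_eqF.
rewrite {}tE {al al0 de58} in de.
(* With this r, the term (1 - alpha) e24 of de6 equals - r psi_1 /\ psi_2 and pairs with the - r
   phi_1 /\ phi_2 that comes from e15; their sum is of type (1, 1). *)
pose r : R := (1 - (t ^+ 2 - 3)) / (2 * (t ^+ 2 - 3) * t ^+ 2).
pose lphi : seq (seq (R * nat)) :=
  [:: [:: (1, 1%N)]; [:: (1, 3%N); (2, 5%N)]; [:: (1, 6%N)]; [:: (1, 8%N)]].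
pose lpsi : seq (seq (R * nat)) :=
  [:: [:: (t, 2%N)]; [:: (- 2 * (t ^+ 2 - 3) * t, 4%N)]; [:: (t^-1, 7%N)];
      [:: (1 + 2 * r, 5%N); (r, 3%N)]].
apply: (@lcoframe_gcs _ G e e_inv e_free lphi lpsi (t ^+ 2 - 3) Gamma k (nth 0 [:: 0; 0; -1; 1])
  (dphiC r (2 * (t ^+ 2 - 3) * t)^-1 (2 / t))
  (dpsiC ((1 + (t ^+ 2 - 3)) / (2 * (t ^+ 2 - 3) * t ^+ 2)) ((1 + 2 * r) / t))) => //.
- have fc1 (a : nat) x : form_comb e [:: (1 : R, a)] x = e a x.
    by rewrite /form_comb big_seq1 scale1r.
  pose o i : 'I_4 := inord i.
  case=> [|[|[|[|[|[|[|[|l]]]]]]]] // _.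
  + exists false, false, (o 0), (o 0), 1, 0 => x; rewrite !inordK //=.
    by rewrite fc1 scale1r scale0r addr0.
  + exists true, false, (o 0), (o 0), t^-1, 0 => x; rewrite !inordK //=.
    by rewrite scale0r addr0 /form_comb big_seq1 scalerA mulVf // scale1r.
  (* The change of basis from (e3, e5) to (e3 + 2 e5, r e3 + (1 + 2 r) e5) has determinant 1; its
     inverse provides the coefficients here and for e5. *)
  + exists false, true, (o 1), (o 3), (1 + 2 * r), (-2) => x; rewrite !inordK //=.
    by apply/rowP => j; rewrite /form_comb !combE !mxE /=; ring.
  + exists true, false, (o 1), (o 0), (- 2 * (t ^+ 2 - 3) * t)^-1, 0 => x; rewrite !inordK //=.
    rewrite scale0r addr0 /form_comb big_seq1 scalerA mulVf ?scale1r //.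
    by rewrite !mulf_neq0 // oppr_eq0 pnatr_eq0.
  + exists true, false, (o 3), (o 1), 1, (- r) => x; rewrite !inordK //=.
    by apply/rowP => j; rewrite /form_comb !combE !mxE /=; ring.
  + exists false, false, (o 2), (o 0), 1, 0 => x; rewrite !inordK //=.
    by rewrite !fc1 scale1r scale0r addr0.
  + exists true, false, (o 2), (o 0), t, 0 => x; rewrite !inordK //=.
    by rewrite scale0r addr0 /form_comb big_seq1 scalerA mulfV // scale1r.
  + exists false, false, (o 3), (o 0), 1, 0 => x; rewrite !inordK //=.
    by rewrite !fc1 scale1r scale0r addr0.
- by apply: dC_integrable; rewrite k2; case/andP: hk.
- exact: dC_bilinear.
- move=> j y z; rewrite /comb /dphiC /dpsiC /w2.
  case: j => [[|[|[|[|j]]]] hj] //=; rewrite ?inordK //= !combE /ce_d /r /=; split; field; by rewrite ?t0 ?nz.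
Qed.
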